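(* Let $t\in\mathbb{N}^+$ and $0<\alpha<1/L$, and let $\{\mathbf{y}_k\}$ be the sequence of NEAR-DGD$^t$ iterates with steplength $\alpha$. If the Lyapunov function $\mathcal{L}_t$ satisfies the strict saddle property, then under random initialization $\mathbf{y}_0$ the sequence $\{\mathbf{y}_k\}$ converges almost surely to a second order stationary point of $\mathcal{L}_t$, i.e. to a point $\mathbf{y}^\infty$ with $\nabla\mathcal{L}_t(\mathbf{y}^\infty)=\mathbf{0}$ and $\nabla^2\mathcal{L}_t(\mathbf{y}^\infty)\succeq 0$.
   Context: Setting. Let $n\ge 2$, $p\ge 1$, and let $\mathcal{G}=(\mathcal{V},\mathcal{E})$ be a connected undirected graph with $\mathcal{V}=\{1,\dots,n\}$. Let $f_i:\mathbb{R}^p\to\mathbb{R}$, $i=1,\dots,n$, be (possibly nonconvex) functions. For $\mathbf{x}=[x_1',\dots,x_n']'\in\mathbb{R}^{np}$ with $x_i\in\mathbb{R}^p$, put $\mathbf{f}(\mathbf{x})=\sum_{i=1}^n f_i(x_i)$. Standing assumptions. (1) $\mathbf{W}\in\mathbb{R}^{n\times n}$ is symmetric, doubly stochastic, positive definite, and $w_{ij}>0$ if $(i,j)\in\mathcal{E}$ or $i=j$, and $w_{ij}=0$ otherwise. (2) $\nabla\mathbf{f}$ is Lipschitz with constant $L>0$: $\|\nabla\mathbf{f}(\mathbf{x})-\nabla\mathbf{f}(\mathbf{y})\|\le L\|\mathbf{x}-\mathbf{y}\|$ for all $\mathbf{x},\mathbf{y}\in\mathbb{R}^{np}$. (3) $\mathbf{f}$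 is coercive: $\mathbf{f}(\mathbf{x}_k)\to\infty$ whenever $\|\mathbf{x}_k\|\to\infty$. (4) The Lyapunov function $\mathcal{L}_t$ below is a KL function. (5) $\mathbf{f}$ is $C^2$. Method. Let $\mathbf{Z}=\mathbf{W}\otimes I_p$, so $\mathbf{Z}^t=\mathbf{W}^t\otimes I_p$. For $t\in\mathbb{N}^+$, $\alpha>0$ and $\mathbf{y}_0\in\mathbb{R}^{np}$, the NEAR-DGD$^t$ iterates are, for $k\ge 0$, $\mathbf{x}_k=\mathbf{Z}^t\mathbf{y}_k$ and $\mathbf{y}_{k+1}=\mathbf{x}_k-\alpha\nabla\mathbf{f}(\mathbf{x}_k)$. Lyapunov function. $\mathcal{L}_t(\mathbf{y})=\mathbf{f}(\mathbf{Z}^t\mathbf{y})+\frac{1}{2\alpha}\langle\mathbf{y},\mathbf{Z}^t\mathbf{y}\rangle-\frac{1}{2\alpha}\langle\mathbf{y},\mathbf{Z}^{2t}\mathbf{y}\rangle$. KL property (for a continuously differentiable $h:\mathbb{R}^N\to\mathbb{R}$). $h$ has the KL property at $x^\star$ if there exist $\eta\in(0,+\infty]$, a neighborhood $U$ of $x^\star$, and a continuous concave function $\phi:[0,\eta)\to[0,\infty)$ such that $\phi(0)=0$, $\phi$ is $C^1$ on $(0,\eta)$, $\phi'(s)>0$ for all $s\in(0,\eta)$, and for all $x\in U$ with $h(x^\star)<h(x)<h(x^\star)+\eta$ the KL inequality $\phi'(h(x)-h(x^\star))\,\|\nabla h(x)\|\ge 1$ holds. $h$ is a KL function if it has the KL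 property at every point. Strict saddles. A strict saddle of a $C^2$ function $h$ is a point $x^\star$ with $\nabla h(x^\star)=0$ and $\lambda_{\min}(\nabla^2h(x^\star))<0$. $h$ satisfies the strict saddle property if every critical point of $h$ is either a strict saddle or a (local) minimizer. Random initialization: $\mathbf{y}_0$ is drawn from a probability distribution on $\mathbb{R}^{np}$ that is absolutely continuous with respect to Lebesgue measure (so the claim holds for all $\mathbf{y}_0$ outside a Lebesgue-null set). *)

(* Defs.v *)
From HB Require Import structures.
From mathcomp Require Import all_boot all_order all_algebra.
From mathcomp Require Import mxtens.
From mathcomp Require Import all_classical all_reals all_analysis.

Set Implicit Arguments.
Unset Strict Implicit.
Unset Printing Implicit Defensive.

Import Order.TTheory GRing.Theory Num.Theory.
Import numFieldNormedType.Exports.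

Local Open Scope classical_set_scope.
Local Open Scope ring_scope.

Section Euclidean.
Context {R : realType} {N : nat}.
Implicit Types (u v x y : 'cV[R]_N) (h : 'cV[R]_N -> R) (A : 'M[R]_N).

(* The library norm on matrices is the sup norm; it induces the same topology
   and the same notion of differentiability as the Euclidean norm below. *)
Definition dotv u v : R := \sum_i u i 0 * v i 0.
Definition enorm u : R := Num.sqrt (dotv u u).

Definition grad h x : 'cV[R]_N := \col_i 'D_(delta_mx i 0) h x.

Definition hessian h x : 'M[R]_N :=
  \matrix_(i, j) 'D_(delta_mx i 0) (fun y => grad h y j 0) x.

Definition C1 h : Prop := (forall x, differentiable h x) /\ continuous (grad h).

Definition C2 h : Prop := C1 h /\ forall i, C1 (fun x => grad h x i 0).

Definition coercive h : Prop :=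
  forall u : nat -> 'cV[R]_N,
    enorm (u k) @[k --> \oo] --> +oo -> h (u k) @[k --> \oo] --> +oo.

Definition posdef A : Prop :=
  A^T = A /\ forall v, v != 0 -> 0 < dotv v (A *m v).

Definition possemidef A : Prop :=
  A^T = A /\ forall v, 0 <= dotv v (A *m v).

(* Meaningful for symmetric A and N > 0: the real spectrum is then finite and
   nonempty, so that the infimum is the smallest eigenvalue. *)
Definition lambda_min A : R := inf [set a : R | eigenvalue A a].

Definition critical h x : Prop := grad h x = 0.

Definition strict_saddle h x : Prop :=
  critical h x /\ lambda_min (hessian h x) < 0.

Definition local_minimizer h x : Prop := \forall y \near x, h x <= h y.

Definition strict_saddle_property h : Prop :=
  forall x, critical h x -> strict_saddle h x \/ local_minimizer h x.

Definition second_order_stationary h x : Prop :=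
  critical h x /\ possemidef (hessian h x).

(* [phi] is a total function of which only the values on [0, eta[ matter. *)
Definition KL_at h (xs : 'cV[R]_N) : Prop :=
  exists (eta : \bar R) (U : set 'cV[R]_N) (phi : R -> R),
  let I := [set s : R | 0 <= s /\ (s%:E < eta)%E] in
  let I0 := [set s : R | 0 < s /\ (s%:E < eta)%E] in
  [/\ (0 < eta)%E /\ nbhs xs U,
      [/\ {within I, continuous phi}, convex_function I (\- phi),
          (forall s, I s -> 0 <= phi s) & phi 0 = 0],
      forall s, I0 s -> derivable phi s 1 /\ {for s, continuous (derive1 phi)},
      forall s, I0 s -> 0 < derive1 phi s
    & forall x, U x -> h xs < h x -> ((h x)%:E < (h xs)%:E + eta)%E ->
        1 <= derive1 phi (h x - h xs) * enorm (grad h x)].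

Definition KL_function h : Prop := forall x, KL_at h x.

End Euclidean.

Section LebesgueCV.
Variables (R : realType) (N : nat).

Definition borel_cV := g_sigma_algebraType (@open 'cV[R]_N).

Definition box (a b : 'cV[R]_N) : set 'cV[R]_N :=
  [set x | forall i, a i 0 <= x i 0 <= b i 0].

(* Lebesgue outer measure; its restriction to the Borel sets is Lebesgue
   measure on R^N. *)
Definition lebesgue_cV (A : set borel_cV) : \bar R :=
  ereal_inf [set s : \bar R | exists a b : nat -> 'cV[R]_N,
    [/\ forall k i, a k i 0 <= b k i 0,
        A `<=` \bigcup_k box (a k) (b k)
      & s = (\sum_(0 <= k <oo) (\prod_i (b k i 0 - a k i 0))%:E)%E]].

End LebesgueCV.

Section Method.
Context {R : realType} {n p : nat}.

Definition doubly_stochastic (W : 'M[R]_n) : Prop :=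
  [/\ forall i j, 0 <= W i j, forall i, \sum_j W i j = 1
    & forall j, \sum_i W i j = 1].

(* The graph is given by its adjacency relation [E]. *)
Definition mixing_matrix (E : rel 'I_n) (W : 'M[R]_n) : Prop :=
  [/\ W^T = W, doubly_stochastic W, posdef W,
      forall i j, E i j || (i == j) -> 0 < W i j
    & forall i j, ~~ (E i j || (i == j)) -> W i j = 0].

Definition block (x : 'cV[R]_(n * p)) (i : 'I_n) : 'cV[R]_p :=
  \col_j x (mxtens_index (i, j)) 0.

Definition aggregate (f : 'I_n -> 'cV[R]_p -> R) (x : 'cV[R]_(n * p)) : R :=
  \sum_i f i (block x i).

Definition kronI (W : 'M[R]_n) : 'M[R]_(n * p) := tensmx W (1%:M : 'M[R]_p).

Section Iterates.
Variables (W : 'M[R]_n) (f : 'I_n -> 'cV[R]_p -> R) (t : nat) (alpha : R).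

Let Z : 'M[R]_(n * p) := kronI W.

Definition near_dgd_x (y : 'cV[R]_(n * p)) : 'cV[R]_(n * p) := Z ^+ t *m y.

Fixpoint near_dgd (y0 : 'cV[R]_(n * p)) (k : nat) : 'cV[R]_(n * p) :=
  if k is k'.+1 then
    let x := near_dgd_x (near_dgd y0 k') in x - alpha *: grad (aggregate f) x
  else y0.

Definition lyapunov (y : 'cV[R]_(n * p)) : R :=
  aggregate f (Z ^+ t *m y)
  + 1 / (2 * alpha) * dotv y (Z ^+ t *m y)
  - 1 / (2 * alpha) * dotv y (Z ^+ (2 * t) *m y).

End Iterates.
End Method.

(* Main.v *)
(** Write [T = Z^t] and [F] for the aggregate objective.  One iteration is
   [g y = T y - alpha * grad F (T y)], and the Lyapunov function [h] satisfies
   [alpha * grad h y = T (y - g y)].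

   Convergence.  The descent lemma gives
   [h (g y) <= h y - |T (g y - y)|^2 / (2 alpha)], coercivity bounds the orbit,
   and along it [|grad h (y_k)|] is at most a constant times
   [|y_(k+1) - y_k|].  If [phi] is the KL function at a limit point [x], then
   concavity bounds [|y_(k+1) - y_k|] by a constant times
   [phi (h y_k - h x) - phi (h y_(k+1) - h x)], which telescopes; so [y_k]
   tends to [x], a fixed point of [g], hence a critical point of [h].

   Avoidance.  No stable manifold is constructed.  Let [A] be the Jacobian of
   [g] at [x]; the matrix [T A] is symmetric, and the Hessian of [h] at [x] is
   [(T - T A) / alpha].  If the latter is not positive semidefinite, there is
   [theta > 1], not an eigenvalue of [A], such that
   [Q d = <d, T (A - theta) d>] takes a positive value.  Near [x] one has
   [Q (g y - g z) >= theta^2 Q (y - z)], so two orbits that stay near [x]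
   satisfy [Q (y - z) <= 0].  The starting points of such orbits therefore form
   a partial Lipschitz graph over a hyperplane, a null set; the same holds for
   its preimages under the iterates of [g], since [g] expands distances by at
   least a positive factor.  Countably many rational balls suffice, so almost
   surely the limit has a positive semidefinite Hessian. *)

Require Import Defs.
From HB Require Import structures.
From mathcomp Require Import all_boot all_order all_algebra.
From mathcomp Require Import mxtens ring lra.
From mathcomp Require Import all_classical all_reals all_analysis.

Set Implicit Arguments.
Unset Strict Implicit.
Unset Printing Implicit Defensive.

Import Order.TTheory GRing.Theory Num.Theory.
Import numFieldNormedType.Exports.

Local Open Scope classical_set_scope.
Local Open Scope ring_scope.

(** * Euclidean space *)

Section EuclideanSpace.
Context {R : realType} {N : nat}.
Implicit Types (u v x y : 'cV[R]_N) (A M : 'M[R]_N) (a : R).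

Lemma dotvC u v : dotv u v = dotv v u.
Proof. by apply: eq_bigr => i _; rewrite mulrC. Qed.

Lemma dotvDr u v x : dotv u (v + x) = dotv u v + dotv u x.
Proof. by rewrite -big_split; apply: eq_bigr => i _; rewrite mxE mulrDr. Qed.

Lemma dotvZr a u v : dotv u (a *: v) = a * dotv u v.
Proof. by rewrite mulr_sumr; apply: eq_bigr => i _; rewrite mxE mulrCA. Qed.

Lemma dotvDl u v x : dotv (u + v) x = dotv u x + dotv v x.
Proof. by rewrite dotvC dotvDr !(dotvC x). Qed.

Lemma dotvZl a u v : dotv (a *: u) v = a * dotv u v.
Proof. by rewrite dotvC dotvZr dotvC. Qed.

Lemma dotvNr u v : dotv u (- v) = - dotv u v.
Proof. by rewrite -scaleN1r dotvZr mulN1r. Qed.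

Lemma dotvNl u v : dotv (- u) v = - dotv u v.
Proof. by rewrite dotvC dotvNr dotvC. Qed.

Lemma dotvBr u v x : dotv u (v - x) = dotv u v - dotv u x.
Proof. by rewrite dotvDr dotvNr. Qed.

Lemma dotvBl u v x : dotv (u - v) x = dotv u x - dotv v x.
Proof. by rewrite dotvDl dotvNl. Qed.

Lemma dotv0l u : dotv 0 u = 0.
Proof. by apply: big1 => i _; rewrite mxE mul0r. Qed.

Lemma dotv0r u : dotv u 0 = 0.
Proof. by rewrite dotvC dotv0l. Qed.

Lemma dotvE u v : dotv u v = (u^T *m v) 0 0.
Proof. by rewrite mxE; apply: eq_bigr => i _; rewrite mxE. Qed.

Lemma dotv_mulmx A u v : dotv u (A *m v) = dotv (A^T *m u) v.
Proof. by rewrite !dotvE trmx_mul trmxK mulmxA. Qed.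

Lemma dotv_sym A u v : A^T = A -> dotv u (A *m v) = dotv v (A *m u).
Proof. by move=> AT; rewrite dotv_mulmx AT dotvC. Qed.

Lemma dotv_delta u i : dotv u (delta_mx i 0) = u i 0.
Proof.
rewrite /dotv (bigD1 i)//= mxE !eqxx mulr1 big1 ?addr0// => j ji.
by rewrite mxE (negbTE ji) mulr0.
Qed.

Lemma dotv_ge0 u : 0 <= dotv u u.
Proof. by apply: sumr_ge0 => i _; rewrite -expr2 sqr_ge0. Qed.

Lemma dotv_eq0 u : dotv u u = 0 -> u = 0.
Proof.
move=> /eqP; rewrite psumr_eq0 => [/allP u0|i _]; last by rewrite -expr2 sqr_ge0.
apply/colP => i; rewrite mxE; apply/eqP.
by have := u0 i (mem_index_enum i); rewrite -expr2 sqrf_eq0.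
Qed.

Lemma quad_ge0_discr (a b c : R) : 0 <= c ->
  (forall s : R, 0 <= a + 2 * s * b + s ^+ 2 * c) -> b ^+ 2 <= a * c.
Proof.
rewrite le_eqVlt => /predU1P[<-|c0] H.
  have [->|b0] := eqVneq b 0; first by rewrite expr0n mulr0.
  (* With [c = 0] the expression is affine in [s], and this [s] gives it the value [-1]. *)
  have := H (- (a + 1) / (2 * b)).
  have -> : a + 2 * (- (a + 1) / (2 * b)) * b + (- (a + 1) / (2 * b)) ^+ 2 * 0 = -1.
    by field.
  lra.
have := H (- b / c).
have -> : a + 2 * (- b / c) * b + (- b / c) ^+ 2 * c = (a * c - b ^+ 2) / c.
  by field; rewrite gt_eqF.
by rewrite pmulr_lge0 ?invr_gt0// subr_ge0.
Qed.

(** The discriminant of [s -> <u + s v, A (u + s v)>] is nonpositive. [A = 1] gives the usual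
    inequality; a general [A] serves in [posdef_le1_contr]. *)
Lemma psd_CauchySchwarz A u v : possemidef A ->
  dotv u (A *m v) ^+ 2 <= dotv u (A *m u) * dotv v (A *m v).
Proof.
move=> [AT A0]; apply: quad_ge0_discr => // s.
have := A0 (u + s *: v).
rewrite mulmxDr -scalemxAr !dotvDl !dotvDr !dotvZl !dotvZr (dotv_sym v u AT).
by congr (_ <= _); ring.
Qed.

Lemma dotv_CauchySchwarz u v : dotv u v ^+ 2 <= dotv u u * dotv v v.
Proof.
have := @psd_CauchySchwarz 1%:M u v; rewrite !mul1mx; apply.
by split=> [|w]; rewrite ?trmx1// mul1mx dotv_ge0.
Qed.

Lemma enorm_ge0 u : 0 <= enorm u.
Proof. exact: sqrtr_ge0. Qed.

Lemma enorm_sqr u : enorm u ^+ 2 = dotv u u.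
Proof. by rewrite sqr_sqrtr ?dotv_ge0. Qed.

Lemma enorm0 : enorm (0 : 'cV[R]_N) = 0.
Proof. by rewrite /enorm dotv0l sqrtr0. Qed.

Lemma enorm_eq0 u : enorm u = 0 -> u = 0.
Proof. by move=> u0; apply: dotv_eq0; rewrite -enorm_sqr u0 expr0n. Qed.

Lemma enorm_gt0 u : u != 0 -> 0 < enorm u.
Proof.
by move=> u0; rewrite lt_neqAle enorm_ge0 andbT eq_sym; apply: contra u0 => /eqP/enorm_eq0->.
Qed.

Lemma enormZ a u : enorm (a *: u) = `|a| * enorm u.
Proof. by rewrite /enorm dotvZl dotvZr mulrA -expr2 sqrtrM ?sqr_ge0// sqrtr_sqr. Qed.

Lemma enormN u : enorm (- u) = enorm u.
Proof. by rewrite -scaleN1r enormZ normrN1 mul1r. Qed.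

Lemma enormBC u v : enorm (u - v) = enorm (v - u).
Proof. by rewrite -enormN opprB. Qed.

Lemma ler_norm_dotv u v : `|dotv u v| <= enorm u * enorm v.
Proof.
rewrite -(@ler_pXn2r _ 2)// ?nnegrE ?mulr_ge0 ?enorm_ge0//.
by rewrite real_normK ?num_real// exprMn !enorm_sqr dotv_CauchySchwarz.
Qed.

Lemma ler_dotv u v : dotv u v <= enorm u * enorm v.
Proof. exact: le_trans (ler_norm _) (ler_norm_dotv _ _). Qed.

Lemma ler_enormD u v : enorm (u + v) <= enorm u + enorm v.
Proof.
rewrite -(@ler_pXn2r _ 2)// ?nnegrE ?addr_ge0 ?enorm_ge0//.
rewrite enorm_sqr dotvDl !dotvDr (dotvC v u) sqrrD !enorm_sqr.
by have := ler_dotv u v; lra.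
Qed.

Lemma ler_enormB u v : enorm (u - v) <= enorm u + enorm v.
Proof. by rewrite -(enormN v) ler_enormD. Qed.

Lemma lerB_enorm u v : enorm u - enorm v <= enorm (u - v).
Proof. by rewrite lerBlDr -{1}(subrK v u) ler_enormD. Qed.

Lemma ler_enorm_dist u v x : enorm (u - x) <= enorm (u - v) + enorm (v - x).
Proof. by rewrite -[u - x](subrKA v) ler_enormD. Qed.

Lemma ler_coord_enorm u i : `|u i 0| <= enorm u.
Proof.
rewrite -(@ler_pXn2r _ 2)// ?nnegrE ?enorm_ge0// enorm_sqr real_normK ?num_real//.
rewrite /dotv (bigD1 i)//= -expr2 lerDl.
by apply: sumr_ge0 => j _; rewrite -expr2 sqr_ge0.
Qed.

Lemma ler_coord_norm u i : `|u i 0| <= `|u|.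
Proof. by rewrite [leRHS]mx_normrE; apply: (le_bigmax _ (fun ij => `|u ij.1 ij.2|) (i, 0)). Qed.

Lemma ler_enorm_sum u : enorm u <= \sum_i `|u i 0|.
Proof.
have s0 : 0 <= \sum_i `|u i 0| by apply: sumr_ge0.
rewrite -(@ler_pXn2r _ 2)// ?nnegrE ?enorm_ge0// enorm_sqr expr2 mulr_suml.
apply: ler_sum => i _; rewrite -expr2 -real_normK ?num_real// expr2 ler_wpM2l//.
by rewrite (bigD1 i)//= lerDl sumr_ge0.
Qed.

Lemma ler_norm_enorm u : `|u| <= enorm u.
Proof.
rewrite {1}/Num.Def.normr/= mx_normrE; apply: bigmax_le; first exact: enorm_ge0.
by move=> [i j] _ /=; rewrite (ord1 j) ler_coord_enorm.
Qed.

Lemma ler_enorm_norm u : enorm u <= N%:R * `|u|.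
Proof.
apply: le_trans (ler_enorm_sum u) _.
rewrite -[N in N%:R]card_ord -sumr_const mulr_suml; apply: ler_sum => i _.
by rewrite mul1r ler_coord_norm.
Qed.

Lemma mulmx_enorm_bound M : exists2 C, 0 < C & forall x, enorm (M *m x) <= C * enorm x.
Proof.
exists (1 + \sum_i \sum_j `|M i j|).
  by rewrite ltr_pwDl ?ltr01// sumr_ge0// => i _; rewrite sumr_ge0.
move=> x; apply: le_trans (ler_enorm_sum _) _.
rewrite mulrDl mul1r -[leLHS]add0r lerD ?enorm_ge0// mulr_suml.
apply: ler_sum => i _; rewrite mxE mulr_suml.
apply: le_trans (ler_norm_sum _ _ _) _; apply: ler_sum => j _.
by rewrite normrM ler_wpM2l// ler_coord_enorm.
Qed.

Lemma unitmx_enorm_bound M : M \in unitmx ->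
  exists2 c, 0 < c & forall x, c * enorm x <= enorm (M *m x).
Proof.
move=> Mu; have [C C0 HC] := mulmx_enorm_bound (invmx M).
exists C^-1; first by rewrite invr_gt0.
by move=> x; rewrite ler_pdivrMl// -{1}[x](mulKmx Mu).
Qed.

(** Bridge to the library topology, which comes from the sup norm: the two norms differ by a factor
    of at most [N]. *)
Lemma nbhs_enormP x (U : set 'cV[R]_N) :
  nbhs x U <-> exists2 d, 0 < d & forall y, enorm (y - x) < d -> U y.
Proof.
split=> [/nbhs_ballP[d /= d0 dU]|[d d0 dU]].
  exists d => // y yx; apply: dU; rewrite -ball_normE /ball_/= distrC.
  exact: le_lt_trans (ler_norm_enorm _) yx.
(* [N.+1] instead of [N] keeps the divisor positive when [N = 0]. *)
apply/nbhs_ballP; exists (d / N.+1%:R); first by rewrite /= divr_gt0.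
move=> y; rewrite -ball_normE /ball_/= distrC => yx; apply: dU.
apply: le_lt_trans (ler_enorm_norm _) _.
rewrite (@le_lt_trans _ _ (N.+1%:R * `|y - x|))//.
  by rewrite ler_wpM2r// ler_nat.
by rewrite -ltr_pdivlMl// mulrC.
Qed.

Lemma cvg_enormP (y : nat -> 'cV[R]_N) x :
  y k @[k --> \oo] --> x <->
  forall e, 0 < e -> exists K, forall k, (K <= k)%N -> enorm (y k - x) < e.
Proof.
split=> [yx e e0|H].
  have /yx [K _ HK] : nbhs x [set z | enorm (z - x) < e] by apply/nbhs_enormP; exists e.
  by exists K => k; exact: HK.
move=> U /nbhs_enormP[d d0 dU]; have [K HK] := H _ d0.
by exists K => // k /HK /dU.
Qed.

Lemma eps_bound (a b C : R) : 0 <= C -> (forall e, 0 < e -> a <= b + e * C) -> a <= b.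
Proof.
move=> C0 H; apply/ler_addgt0Pr => e e0.
have C1 : 0 < C + 1 by rewrite ltr_wpDl.
apply: le_trans (H (e / (C + 1)) _) _; first by rewrite divr_gt0.
rewrite lerD2l mulrAC ler_pdivrMr// ler_wpM2l ?ltW//; lra.
Qed.

End EuclideanSpace.

(** * Strict differentiability *)

Section Calculus.
Context {R : realType} {N : nat}.
Implicit Types (u v x y z : 'cV[R]_N) (h : 'cV[R]_N -> R) (M : 'M[R]_N).

Lemma derive_grad h x v : differentiable h x -> 'D_v h x = dotv (grad h x) v.
Proof.
move=> dh; rewrite deriveE// [v in LHS]matrix_sum_delta linear_sum.
apply: eq_bigr => i _; rewrite big_ord1 linearZ /= mulrC mxE deriveE//.
Qed.

Lemma is_derive_line h x v (s : R) : (forall y, differentiable h y) ->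
  is_derive s 1 (fun s : R => h (x + s *: v)) (dotv (grad h (x + s *: v)) v).
Proof.
move=> dh.
have dl : is_diff s (cst x + *:%R^~ v) (0 + *:%R^~ v) by apply: is_diffD.
have lE : 'd (fun s : R => x + s *: v) s = (fun s => *:%R s v) :> (R -> _).
  by rewrite (@diff_val _ _ _ _ _ _ _ dl) add0r.
have ddl : differentiable (fun s : R => x + s *: v) s by exact: ex_diff.
have dc : differentiable (h \o (fun s : R => x + s *: v)) s.
  exact: differentiable_comp.
split; first exact/derivable1_diffP.
rewrite deriveE// diff_comp//= lE scale1r -deriveE//.
exact: derive_grad.
Qed.

Lemma continuous_line h x v : (forall y, differentiable h y) ->
  continuous (fun s : R => h (x + s *: v)).
Proof.
move=> dh s; apply: differentiable_continuous; apply/derivable1_diffP.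
by have [] := is_derive_line x v s dh.
Qed.

Lemma mean_value_grad h x v : (forall y, differentiable h y) ->
  exists2 c : R, 0 < c < 1 & h (x + v) - h x = dotv (grad h (x + c *: v)) v.
Proof.
move=> dh.
have [c + E] := @MVT R (fun s => h (x + s *: v)) (fun s => dotv (grad h (x + s *: v)) v)
  0 1 ltr01 (fun s _ => is_derive_line x v s dh)
  (continuous_subspaceT (@continuous_line h x v dh)).
rewrite in_itv /= => c01; exists c => //.
by move: E; rewrite scale1r scale0r addr0 subr0 mulr1.
Qed.

(** Strict differentiability: both points vary near [x], as is required to compare two orbits near a
    saddle. *)
Definition strict_diff (Phi : 'cV[R]_N -> 'cV[R]_N) x M : Prop :=
  forall e, 0 < e -> exists2 d, 0 < d & forall y z,
    enorm (y - x) < d -> enorm (z - x) < d ->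
    enorm (Phi y - Phi z - M *m (y - z)) <= e * enorm (y - z).

Lemma enorm_segment x y z (d c : R) : 0 < c < 1 ->
  enorm (y - x) < d -> enorm (z - x) < d -> enorm (z + c *: (y - z) - x) < d.
Proof.
move=> /andP[c0 c1] yd zd.
have -> : z + c *: (y - z) - x = (1 - c) *: (z - x) + c *: (y - x).
  by apply/colP => i; rewrite !mxE; ring.
apply: le_lt_trans (ler_enormD _ _) _; rewrite !enormZ.
rewrite !ger0_norm ?ltW// ?subr_gt0//.
rewrite (_ : d = (1 - c) * d + c * d); last by ring.
by apply: ltrD; rewrite ltr_pM2l// subr_gt0.
Qed.

(** Mean value theorem for each coordinate of the gradient, then continuity of the second
    derivatives. The transpose appears because [hessian] indexes the differentiated coordinate by
    columns. *)
Lemma strict_diff_grad h x : C2 h -> strict_diff (grad h) x (hessian h x)^T.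
Proof.
move=> [[dh cg] Hi] e e0.
pose e' : R := e / N.+1%:R.
have e'0 : 0 < e' by rewrite divr_gt0.
have Hd j : exists2 d, 0 < d & forall y, enorm (y - x) < d ->
    enorm (grad (fun w => grad h w j 0) y - grad (fun w => grad h w j 0) x) < e'.
  pose G := grad (fun w => grad h w j 0).
  have [_ cj] := Hi j.
  suff /nbhs_enormP : nbhs x [set y | enorm (G y - G x) < e'] by [].
  by apply: (cj x [set w | enorm (w - G x) < e']); apply/nbhs_enormP; exists e'.
pose dd j := projT1 (cid2 (Hd j)).
have dd0 j : 0 < dd j by rewrite /dd; case: (cid2 _).
have ddP j y : enorm (y - x) < dd j ->
    enorm (grad (fun w => grad h w j 0) y - grad (fun w => grad h w j 0) x) < e'.
  by rewrite /dd; case: (cid2 _) => /= d _; apply.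
(* The default 1 gives a positive radius even when [N = 0]. *)
exists (\big[Order.min/1]_j dd j).
  by apply/bigmin_gtP; split => // j _; exact: dd0.
move=> y z yd zd.
apply: le_trans (ler_enorm_sum _) _.
apply: (@le_trans _ _ (\sum_(j < N) e' * enorm (y - z))); last first.
  rewrite sumr_const card_ord -mulr_natl mulrA ler_wpM2r ?enorm_ge0//.
  rewrite /e' mulrCA -[leRHS]mulr1 ler_wpM2l ?ltW// ltr_pdivrMr//.
  by rewrite mul1r ltr_nat.
apply: ler_sum => j _.
have [c c01 E] := @mean_value_grad (fun w => grad h w j 0) z (y - z) (proj1 (Hi j)).
rewrite mxE [X in X + _]mxE [(- grad h z) j 0]mxE.
move: E; rewrite (addrC z) subrK => ->.
have -> : (- ((hessian h x)^T *m (y - z))) j 0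
  = - dotv (grad (fun w => grad h w j 0) x) (y - z).
  rewrite mxE; congr (- _); rewrite mxE; apply: eq_bigr => i _.
  by rewrite !mxE.
rewrite -dotvBl; apply: le_trans (ler_norm_dotv _ _) _.
rewrite ler_wpM2r ?enorm_ge0// ltW//; apply: ddP.
apply: lt_le_trans (enorm_segment c01 yd zd) _.
exact: bigmin_le.
Qed.

Lemma strict_diff_derive Phi x M v j : strict_diff Phi x M ->
  'D_v (fun y => Phi y j 0) x = (M *m v) j 0.
Proof.
move=> HM; apply: cvg_lim => //; apply/cvgrPdist_le => e e0.
have v1 : 0 < enorm v + 1 by rewrite ltr_wpDl// enorm_ge0.
have [d d0 Hd] := HM (e / (enorm v + 1)) (divr_gt0 e0 v1).
near=> s.
have s0 : s != 0 by near: s; exact: nbhs_dnbhs_neq.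
have sd : `|s| < d / (enorm v + 1).
  by near: s; apply: dnbhs0_lt; rewrite divr_gt0.
have svE : s *: v + x - x = s *: v by rewrite addrK.
have := Hd (s *: v + x) x; rewrite subrr enorm0 svE => /(_ _ d0) {}Hd.
have -> : (M *m v) j 0 - s^-1 *: (((fun y => Phi y j 0) \o shift x) (s *: v) - Phi x j 0)
    = - (s^-1 * (Phi (s *: v + x) - Phi x - M *m (s *: v)) j 0).
  by rewrite -scalemxAr !mxE /= /GRing.scale /=; field.
rewrite normrN normrM normfV ler_pdivrMl ?normr_gt0//.
apply: le_trans (ler_coord_enorm _ _) _; apply: le_trans (Hd _) _.
  rewrite enormZ; apply: (@le_lt_trans _ _ (`|s| * (enorm v + 1))).
    by rewrite ler_wpM2l// lerDl.
  by rewrite -ltr_pdivlMr.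
rewrite enormZ mulrCA ler_wpM2l// mulrAC ler_pdivrMr// ler_wpM2l ?ltW//.
by rewrite ltrDl.
Unshelve. all: by end_near. Qed.

Lemma strict_diff_hessian h x M : strict_diff (grad h) x M -> hessian h x = M^T.
Proof.
move=> HM; apply/matrixP => i j; rewrite !mxE (strict_diff_derive _ _ HM).
rewrite mxE (bigD1 i)//= mxE !eqxx mulr1 big1 ?addr0// => k ki.
by rewrite mxE (negbTE ki) mulr0.
Qed.

(** The mean value theorem along [v], applied to [s -> h (x + u + s v) - h (x + s v)], turns the
    second difference into a difference of gradients, which strict differentiability controls. *)
Lemma second_difference h x M : (forall y, differentiable h y) ->
  strict_diff (grad h) x M ->
  forall e, 0 < e -> exists2 d, 0 < d & forall u v, enorm u + enorm v < d ->
    `|h (x + u + v) - h (x + u) - (h (x + v) - h x) - dotv (M *m u) v|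
      <= e * enorm u * enorm v.
Proof.
move=> dh HM e e0; have [d d0 Hd] := HM e e0; exists d => // u v uvd.
pose phi (s : R) := h (x + u + s *: v) - h (x + s *: v).
pose dphi (s : R) := dotv (grad h (x + u + s *: v) - grad h (x + s *: v)) v.
have dphiP (s : R) : is_derive s 1 phi (dphi s).
  rewrite /dphi dotvBl.
  by apply: is_deriveB; exact: is_derive_line.
have cphi : continuous phi.
  by move=> s; apply: continuousB; exact: continuous_line.
have [c + E] := @MVT R phi dphi 0 1 ltr01 (fun s _ => dphiP s)
  (continuous_subspaceT cphi).
rewrite in_itv /= => /andP[c0 c1].
move: E; rewrite /phi /dphi scale1r scale0r !addr0 subr0 mulr1.
rewrite opprB addrA => E.
rewrite (_ : _ - dotv _ _ =
  dotv (grad h (x + u + c *: v) - grad h (x + c *: v) - M *m u) v); last first.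
  by rewrite [in RHS]dotvBl -E; ring.
apply: le_trans (ler_norm_dotv _ _) _; rewrite ler_wpM2r ?enorm_ge0//.
have cv : enorm (c *: v) <= enorm v.
  by rewrite enormZ gtr0_norm// ler_piMl ?enorm_ge0// ltW.
have uE : u = x + u + c *: v - (x + c *: v) by apply/colP => i; rewrite !mxE; ring.
rewrite [X in M *m X]uE [X in _ <= _ * enorm X]uE; apply: Hd.
  rewrite (_ : _ - x = u + c *: v); last by apply/colP => i; rewrite !mxE; ring.
  apply: le_lt_trans (ler_enormD _ _) _.
  by apply: le_lt_trans uvd; rewrite lerD2l.
rewrite addrAC subrr add0r; apply: le_lt_trans cv _; apply: le_lt_trans uvd.
by rewrite lerDr enorm_ge0.
Qed.

(** Schwarz's theorem: the second difference is symmetric in [u] and [v]. Two uses of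
    [second_difference] on [s u] and [s v], divided by [s^2], leave an error [2 e |u| |v|]. *)
Lemma strict_diff_grad_sym h x M : (forall y, differentiable h y) ->
  strict_diff (grad h) x M -> M^T = M.
Proof.
move=> dh HM.
suff H u v : dotv (M *m u) v <= dotv (M *m v) u.
  have {}H u v : dotv (M *m u) v = dotv (M *m v) u by apply/eqP; rewrite eq_le !H.
  apply/matrixP => i j; rewrite mxE.
  have D k l : dotv (M *m delta_mx k 0) (delta_mx l 0) = M l k.
    rewrite dotv_delta mxE (bigD1 k)//= mxE !eqxx mulr1 big1 ?addr0// => m mk.
    by rewrite mxE (negbTE mk) mulr0.
  by rewrite -!D H.
apply: (@eps_bound _ _ _ (2 * (enorm u * enorm v))).
  by rewrite !mulr_ge0 ?enorm_ge0.
move=> e e0; have [d d0 Hd] := second_difference dh HM e0.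
pose b := enorm u + enorm v + 1.
have b0 : 0 < b by rewrite /b ltr_wpDl// addr_ge0 ?enorm_ge0.
pose s := d / 2 / b.
have s0 : 0 < s by rewrite !divr_gt0// invr_gt0.
have sb : s * (enorm u + enorm v) < d.
  apply: (@le_lt_trans _ _ (s * b)); first by rewrite ler_wpM2l ?ltW// /b ltrDl.
  by rewrite /s divfK ?gt_eqF//; lra.
have H1 := Hd (s *: u) (s *: v); have H2 := Hd (s *: v) (s *: u).
move: H1 H2; rewrite !enormZ !(gtr0_norm s0) -!mulrDr [enorm v + _]addrC => /(_ sb) H1 /(_ sb).
rewrite [x + _ + _]addrAC; move: H1.
rewrite -!scalemxAr !dotvZl !dotvZr !ler_norml => /andP[H1 _] /andP[_ H2].
rewrite -(ler_pM2l (mulr_gt0 s0 s0)).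
lra.
Qed.
End Calculus.
(** * Convergence under the KL inequality *)

Section Descent.
Context {R : realType} {N : nat}.
Implicit Types (u v x : 'cV[R]_N) (h : 'cV[R]_N -> R).

(** Subtract the quadratic bound [q] along the line: by Cauchy-Schwarz and the Lipschitz property,
    the derivative of the difference is nonpositive on [(0, 1)]. *)
Lemma descent_lemma h (L : R) x v : (forall y, differentiable h y) ->
  (forall y z, enorm (grad h y - grad h z) <= L * enorm (y - z)) ->
  h (x + v) <= h x + dotv (grad h x) v + L / 2 * dotv v v.
Proof.
move=> dh Lh.
pose a := dotv (grad h x) v; pose b := L / 2 * dotv v v.
pose q : {poly R} := a *: 'X + b *: 'X ^+ 2.
pose phi (s : R) := h (x + s *: v) - q.[s].
pose dphi (s : R) := dotv (grad h (x + s *: v)) v - (q^`()).[s].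
have dphiP (s : R) : is_derive s 1 phi (dphi s).
  by apply: is_deriveB; exact: is_derive_line.
have cphi : continuous phi.
  by move=> s; apply: continuousB; [exact: continuous_line|exact: continuous_horner].
have [c + E] := @MVT R phi dphi 0 1 ltr01 (fun s _ => dphiP s)
  (continuous_subspaceT cphi).
rewrite in_itv /= => /andP[c0 c1].
have : dphi c <= 0.
  rewrite /dphi /q derivD !derivZ derivX derivXn !hornerE /=.
  have := Lh (x + c *: v) x; rewrite addrAC subrr add0r enormZ gtr0_norm// => H.
  have := ler_dotv (grad h (x + c *: v) - grad h x) v.
  rewrite dotvBl -/a => H'.
  have : enorm (grad h (x + c *: v) - grad h x) * enorm v <= L * (c * enorm v) * enorm v.
    by rewrite ler_wpM2r// enorm_ge0.
  rewrite /b -enorm_sqr.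
  by lra.
move: E; rewrite /phi /q !hornerE /= scale1r scale0r addr0 -/a -/b.
lra.
Qed.

Lemma coercive_sublevel_bounded h (c : R) : coercive h ->
  exists r, forall x, h x <= c -> enorm x <= r.
Proof.
move=> ch; apply: contrapT => /forallNP H.
have {}H (k : nat) : exists x, h x <= c /\ k%:R < enorm x.
  have /existsNP[x /not_implyP[hx /negP]] := H k%:R.
  by rewrite -ltNge => kx; exists x.
have [u Hu] := choice H.
have : enorm (u k) @[k --> \oo] --> +oo.
  apply/cvgryPge => A; near=> k; apply: le_trans (ltW (proj2 (Hu k))).
  by near: k; exact: nbhs_infty_ger.
move=> /ch /cvgryPgt /(_ c) [K _ /(_ K (leqnn K))] /=.
by rewrite ltNge (proj1 (Hu K)).
Unshelve. all: by end_near. Qed.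

(** Bolzano-Weierstrass, through the compactness of a product of segments, which [rV_compact] states
    for row vectors; hence the transpositions. *)
Lemma bounded_limit_point (y : nat -> 'cV[R]_N) (r : R) :
  (forall k, enorm (y k) <= r) ->
  exists x, forall e, 0 < e -> forall K, exists2 k, (K <= k)%N & enorm (y k - x) < e.
Proof.
move=> yr.
have := @rV_compact R N (fun=> `[- r, r]%classic) (fun=> @segment_compact _ _ _).
move=> /(_ ((fun k => (y k)^T) @ \oo) _) [].
  exists 0%N => // k _ i /=; rewrite mxE in_itv /= -ler_norml.
  exact: le_trans (ler_coord_enorm _ _) (yr k).
move=> v [_ vcl]; exists v^T => e e0 K.
pose e' := e / N.+1%:R.
have e'0 : 0 < e' by rewrite divr_gt0.
have FA : ((fun k => (y k)^T) @ \oo) [set w | exists2 k, (K <= k)%N & w = (y k)^T].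
  by exists K => // k Kk; exists k.
have nB : nbhs v [set w : 'rV[R]_N | forall i, ball (v 0 i) e' (w 0 i)].
  exists (fun i j => ball (v i j) e'); first by move=> i j; exact: nbhsx_ballx.
  by move=> w Hw i; exact: Hw.
have [w [[k Kk ->] Hw]] := vcl _ _ FA nB.
exists k => //; apply: le_lt_trans (ler_enorm_sum _) _.
apply: (@le_lt_trans _ _ (\sum_(i < N) e')).
  apply: ler_sum => i _; have := Hw i.
  by rewrite -ball_normE /= !mxE distrC => /ltW.
rewrite sumr_const card_ord -mulr_natl /e' mulrA ltr_pdivrMr// mulrC.
by rewrite ltr_pM2l// ltr_nat.
Qed.

(** If the chord slope [q] were below the derivative at [s], the graph just left of [s] would lie
    under the chord, against concavity. *)
Lemma concave_tangent (D : set R) (phi : R -> R) (r s : R) :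
  convex_function D (\- phi) -> D r -> D s -> r < s -> derivable phi s 1 ->
  derive1 phi s * (s - r) <= phi s - phi r.
Proof.
move=> cphi Dr Ds rs dphi; have sr : 0 < s - r by rewrite subr_gt0.
rewrite -ler_pdivlMr//; set q := _ / _; rewrite leNgt; apply/negP => qphi.
have : (fun h : R => h^-1 *: ((phi \o shift s) (h *: 1) - phi s)) @ 0^' --> derive1 phi s.
  by rewrite derive1E.
move=> /cvgr_gt /(_ _ qphi) /nbhs_ballP[d /= d0 Hd].
(* [t r + (1 - t) s] is then a point of the segment at distance less than [d] from [s]. *)
pose t := Num.min (1 / 2) (d / 2 / (s - r)).
have t0 : 0 < t by rewrite lt_min !divr_gt0.
have t1 : t <= 1 by rewrite ge_min; apply/orP; left; lra.
have tsr : t * (s - r) < d.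
  apply: (@le_lt_trans _ _ (d / 2)); last by lra.
  by rewrite -ler_pdivlMr// ge_min lexx orbT.
pose h := - (t * (s - r)).
have h0 : h < 0 by rewrite oppr_lt0 mulr_gt0.
have := Hd h; rewrite -ball_normE /= sub0r normrN ltr0_norm// opprK.
move=> /(_ tsr (negbT (lt_eqF h0))).
rewrite /GRing.scale /= mulr1 ltr_ndivlMl//.
have -> : h * q = t * (phi r - phi s).
  by rewrite /h /q; field; rewrite gt_eqF.
have := @cphi (Itv01 (ltW t0) t1) r s; rewrite !inE => /(_ Dr Ds).
rewrite convRE /= /conv /= /GRing.scale /=.
have -> : t * r + (1 - t) * s = h + s by rewrite /h; ring.
by rewrite /unstable.onem; lra.
Qed.

(** Abstract descent scheme: sufficient decrease with constant [a], gradient bounded by the step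
    length with constant [b]. Once close enough to a limit point, the sequence has too little length
    left to escape. *)
Lemma KL_convergence h (y : nat -> 'cV[R]_N) (a b r : R) :
  continuous h -> KL_function h -> 0 < a -> 0 < b ->
  (forall k, enorm (y k) <= r) ->
  (forall k, h (y k.+1) <= h (y k) - a * enorm (y k.+1 - y k) ^+ 2) ->
  (forall k, enorm (grad h (y k)) <= b * enorm (y k.+1 - y k)) ->
  exists x, y k @[k --> \oo] --> x.
Proof.
move=> ch KL a0 b0 yr desc gb.
have [x limx] := bounded_limit_point yr; exists x.
have hS k : h (y k.+1) <= h (y k).
  by apply: le_trans (desc k) _; rewrite gerBl mulr_ge0 ?sqr_ge0// ltW.
have hD k j : (k <= j)%N -> h (y j) <= h (y k).
  move=> /subnK <-; elim: (j - k)%N => // i IH.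
  exact: le_trans (hS _) IH.
have near_h e : 0 < e -> exists2 d, 0 < d & forall z, enorm (z - x) < d -> `|h z - h x| < e.
  move=> e0; apply/(@nbhs_enormP _ _ x [set z | `|h z - h x| < e]).
  by have /cvgrPdistC_lt/(_ _ e0) := ch x.
have hx k : h x <= h (y k).
  rewrite leNgt; apply/negP => hk.
  have gap : 0 < h x - h (y k) by rewrite subr_gt0.
  have [d d0 Hd] := near_h _ gap.
  have [j kj /Hd] := limx d d0 k.
  rewrite ltr_norml => /andP[+ _]; have := hD _ _ kj; lra.
have hlim e : 0 < e -> exists K, forall k, (K <= k)%N -> h (y k) < h x + e.
  move=> e0; have [d d0 Hd] := near_h e e0.
  have [K _ /Hd] := limx d d0 0%N; rewrite ltr_norml => /andP[_ hK].
  by exists K => k /hD; lra.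
apply/cvg_enormP => e e0.
(* The KL inequality concerns only values strictly above [h x]. If [h x] is attained, sufficient
   decrease freezes the sequence, necessarily at its limit point. *)
have [[K hK]|] := pselect (exists K, h (y K) = h x).
  have st k : (K <= k)%N -> y k.+1 = y k.
    move=> Kk; apply/eqP; rewrite -subr_eq0; apply/eqP/enorm_eq0/eqP.
    have : a * enorm (y k.+1 - y k) ^+ 2 <= 0.
      have := desc k; have := hx k.+1; have := hD _ _ Kk; lra.
    by rewrite pmulr_rle0// -sqrf_eq0 eq_le sqr_ge0 andbT.
  have stK k : (K <= k)%N -> y k = y K.
    move=> /subnK <-; elim: (k - K)%N => // i <-.
    by rewrite addSn st// leq_addl.
  have [j Kj yj] := limx e e0 K.
  by exists K => k Kk; rewrite stK// -(stK _ Kj).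
move=> /forallNP hne.
have hgt k : h x < h (y k).
  by rewrite lt_neqAle hx andbT eq_sym; apply/eqP/hne.
have [eta [U [phi [[eta0 nU] [cphi concphi phi0 phi00] dphi dphi0 KLi]]]] := KL x.
have [d d0 Hd] := (nbhs_enormP _ _).1 nU.
pose e1 := Num.min e d.
have e10 : 0 < e1 by rewrite lt_min e0.
(* A finite level below [eta], which may be [+oo]. *)
have [s0 s00 s0eta] : exists2 s0 : R, 0 < s0 & (s0%:E < eta)%E.
  case: eta eta0 {nU cphi concphi phi0 dphi dphi0 KLi} => [q| |]//.
    by rewrite lte_fin => q0; exists (q / 2); rewrite ?lte_fin; lra.
  by move=> _; exists 1; rewrite ?ltry.
set I := [set s : R | _] in cphi concphi phi0.
have c0 : 0 < a / b by rewrite divr_gt0.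
(* By continuity of [phi] at 0: the length still to be travelled stays below half the radius
   [e1]. *)
have [d2 d20 Hd2] : exists2 d2, 0 < d2 & forall s, I s -> `|s| < d2 -> phi s < a / b * (e1 / 2).
  have I0 : I 0 by split.
  have := (proj1 (@subspace_continuousP _ I _ phi) cphi) 0 I0; rewrite phi00.
  move=> /cvgr_lt /(_ (a / b * (e1 / 2))); rewrite mulr_gt0// ?divr_gt0// => /(_ isT).
  move=> /nbhs_ballP[d2 /= d20 Hd2]; exists d2 => // s Is sd2.
  by apply: (Hd2 s) => //; rewrite -ball_normE /= sub0r normrN.
have sd20 : 0 < Num.min s0 d2 by rewrite lt_min s00.
have [K1 HK1] := hlim _ sd20.
pose s k := h (y k) - h x.
have sI k : (K1 <= k)%N -> 0 < s k /\ ((s k)%:E < eta)%E.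
  move=> /HK1; rewrite -ltrBlDl lt_min => /andP[sks0 _]; split.
    by rewrite subr_gt0.
  by apply: lt_trans s0eta; rewrite lte_fin.
have sI' k : (K1 <= k)%N -> I (s k) by move=> /sI[/ltW ? ?].
have phis k : (K1 <= k)%N -> phi (s k) < a / b * (e1 / 2).
  move=> Kk; apply: Hd2; first exact: sI'.
  rewrite gtr0_norm ?subr_gt0//; have := HK1 _ Kk.
  by rewrite -ltrBlDl lt_min => /andP[].
(* With [D] the step length, KL gives [phi' (s k) >= 1 / (b D)]; multiplied by the decrease [a D^2],
   it yields [(a / b) D]. The case [D = 0] is apart since the tangent bound requires
   [s k.+1 < s k]. *)
have step k : (K1 <= k)%N -> enorm (y k - x) < d ->
    a / b * enorm (y k.+1 - y k) <= phi (s k) - phi (s k.+1).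
  move=> Kk ykd; have [D0|Dn0] := eqVneq (y k.+1 - y k) 0.
    by move: (D0) => /eqP; rewrite subr_eq0 /s D0 enorm0 => /eqP->; rewrite mulr0 subrr.
  have D0 := enorm_gt0 Dn0; set D := enorm _ in D0 *.
  have Dsq : a * D ^+ 2 <= s k - s k.+1 by have := desc k; rewrite /s -/D; lra.
  have [sk0 sketa] := sI _ Kk.
  have skS : s k.+1 < s k.
    by rewrite -subr_gt0; apply: lt_le_trans Dsq; rewrite mulr_gt0// exprn_gt0.
  have [dphik _] := dphi (s k) (conj sk0 sketa).
  have dphik0 := dphi0 (s k) (conj sk0 sketa).
  have := concave_tangent concphi (sI' _ (leqW Kk)) (sI' _ Kk) skS dphik.
  apply: le_trans.
  have := KLi (y k) (Hd _ ykd) (hgt k).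
  rewrite -lteBlDl// -EFinB => /(_ sketa) KLk.
  have bD : 1 <= phi^`()%classic (s k) * (b * D).
    by apply: le_trans KLk _; apply: ler_wpM2l; [exact: ltW|exact: gb].
  apply: (@le_trans _ _ (phi^`()%classic (s k) * (a * D ^+ 2))); last first.
    by rewrite ler_wpM2l// ltW.
  have -> : phi^`()%classic (s k) * (a * D ^+ 2) = a / b * D * (phi^`()%classic (s k) * (b * D)).
    by field; rewrite gt_eqF.
  by rewrite ler_peMr// mulr_ge0 ?ltW.
have e12 : 0 < e1 / 2 by rewrite divr_gt0.
have e1d : e1 <= d by rewrite ge_min lexx orbT.
have [k0 K1k0 yk0] := limx _ e12 K1.
(* Joint induction: [step] requires closeness to [x], and closeness follows from the telescoped
   bound, [e1 / 2] for the travelled distance and [e1 / 2] for [y k0]. *)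
have tele i : a / b * enorm (y (i + k0)%N - y k0) <= phi (s k0) - phi (s (i + k0)%N)
    /\ enorm (y (i + k0)%N - x) < e1.
  have close j : a / b * enorm (y (j + k0)%N - y k0) <= phi (s k0) - phi (s (j + k0)%N) ->
      enorm (y (j + k0)%N - x) < e1.
    move=> Hj; apply: le_lt_trans (ler_enorm_dist _ (y k0) _) _.
    rewrite (splitr e1) ltrD// -(ltr_pM2l c0).
    apply: le_lt_trans Hj _; apply: le_lt_trans (phis _ K1k0).
    by rewrite gerBl phi0//; apply: sI'; rewrite (leq_trans K1k0)// leq_addl.
  elim: i => [|i [IH1 IH2]].
    have H0 : a / b * enorm (y (0 + k0)%N - y k0) <= phi (s k0) - phi (s (0 + k0)%N).
      by rewrite add0n !subrr enorm0 mulr0.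
    by split => //; exact: close.
  have H1 : a / b * enorm (y (i.+1 + k0)%N - y k0) <= phi (s k0) - phi (s (i.+1 + k0)%N).
    apply: le_trans (_ : a / b * (enorm (y (i + k0).+1 - y (i + k0)%N)
      + enorm (y (i + k0)%N - y k0)) <= _).
      by apply: ler_wpM2l; [exact: ltW|exact: ler_enorm_dist].
    have := step (i + k0)%N (leq_trans K1k0 (leq_addl _ _)).
    move=> /(_ (lt_le_trans IH2 e1d)); rewrite mulrDr addSn; lra.
  by split => //; exact: close.
exists k0 => k /subnK <-; apply: lt_le_trans (proj2 (tele _)) _.
by rewrite ge_min lexx.
Qed.
End Descent.
(** * The iteration and its Lyapunov function *)

Section Lyapunov.
Context {R : realType} {N : nat}.
Implicit Types (u v x y z : 'cV[R]_N) (M : 'M[R]_N).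

Lemma continuous_mulmx M : continuous (fun y => M *m y).
Proof.
move=> x U /nbhs_enormP[d d0 dU]; have [C C0 HC] := mulmx_enorm_bound M.
apply/nbhs_enormP; exists (d / C); first by rewrite divr_gt0.
move=> y yx; apply: dU; rewrite -mulmxBr; apply: le_lt_trans (HC _) _.
by rewrite -ltr_pdivlMl// mulrC.
Qed.

Lemma continuous_quadratic M : continuous (fun y => dotv y (M *m y)).
Proof.
suff : continuous (fun y => \sum_i y i 0 * (M *m y) i 0) by [].
apply: continuous_big; [exact: add_continuous|move=> i _ x].
apply: continuousM; first exact: coord_continuous.
apply: (@continuous_comp _ _ _ (fun y => M *m y) (fun z => z i 0)).
  exact: continuous_mulmx.
exact: coord_continuous.
Qed.

Lemma derive_line (h : 'cV[R]_N -> R) x v (d : R) :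
  is_derive (0 : R) 1 (fun s : R => h (x + s *: v)) d -> 'D_v h x = d.
Proof.
move=> [_ <-]; rewrite /derive.
suff -> : (fun r : R => r^-1 *: ((h \o shift x) (r *: v) - h x)) = (fun r : R =>
  r^-1 *: (((fun s : R => h (x + s *: v)) \o shift 0) (r *: 1) - h (x + 0 *: v))) by [].
apply/funext => s /=.
by rewrite addr0 [s%:A]mulr1 scale0r addr0 [s *: v + x]addrC.
Qed.

Variables (T : 'M[R]_N) (F : 'cV[R]_N -> R) (L alpha : R).

(** The Kronecker structure is abstracted away: [T] is symmetric and invertible with [T^2 <= T], so
    its spectrum lies in [(0, 1]]. *)
Definition dgd_step y := T *m y - alpha *: grad F (T *m y).

Definition dgd_lyapunov y := F (T *m y) + 1 / (2 * alpha) * dotv y (T *m y)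
  - 1 / (2 * alpha) * dotv y (T *m (T *m y)).

Hypothesis T_sym : T^T = T.
Hypothesis T_contr : forall x, dotv (T *m x) (T *m x) <= dotv x (T *m x).
Hypothesis T_unit : T \in unitmx.
Hypothesis alpha_gt0 : 0 < alpha.
Hypothesis L_gt0 : 0 < L.
Hypothesis alphaL_lt1 : alpha * L < 1.
Hypothesis F_diff : forall y, differentiable F y.
Hypothesis F_lip : forall y z, enorm (grad F y - grad F z) <= L * enorm (y - z).

Local Notation g := dgd_step.
Local Notation h := dgd_lyapunov.

Lemma T_le1 x : enorm (T *m x) <= enorm x.
Proof.
have [->|Tx0] := eqVneq (T *m x) 0; first by rewrite enorm0 enorm_ge0.
rewrite -(ler_pM2r (enorm_gt0 Tx0)) -expr2 enorm_sqr.
exact: le_trans (T_contr x) (ler_dotv _ _).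
Qed.

Lemma T_adj u w : dotv (T *m u) w = dotv u (T *m w).
Proof. by rewrite dotv_mulmx T_sym. Qed.

(** The coefficient of [s] yields the gradient, and [s = 1] the descent estimate. *)
Lemma lyapunov_line x v (s : R) :
  h (x + s *: v) = F (T *m x + s *: (T *m v)) +
    (1 / (2 * alpha)) * ((dotv x (T *m x) - dotv (T *m x) (T *m x))
      + s * (2 * (dotv x (T *m v) - dotv (T *m x) (T *m v)))
      + s ^+ 2 * (dotv v (T *m v) - dotv (T *m v) (T *m v))).
Proof.
rewrite /h mulmxDr -scalemxAr mulmxDr -scalemxAr !dotvDl !dotvDr !dotvZl !dotvZr.
have TT u w : dotv u (T *m (T *m w)) = dotv (T *m u) (T *m w) by rewrite dotv_mulmx T_sym.
rewrite !TT (dotv_sym v x T_sym) (dotvC (T *m v) (T *m x)).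
by field; rewrite gt_eqF.
Qed.

Lemma grad_lyapunov y : grad h y = alpha^-1 *: (T *m (y - g y)).
Proof.
apply/colP => i; rewrite mxE -dotv_delta; set v := delta_mx i 0.
apply: derive_line.
pose a := dotv y (T *m v) - dotv (T *m y) (T *m v).
pose b := (dotv v (T *m v) - dotv (T *m v) (T *m v)).
pose c := dotv y (T *m y) - dotv (T *m y) (T *m y).
pose q : {poly R} := (1 / (2 * alpha)) *: (c%:P + (2 * a) *: 'X + b *: 'X ^+ 2).
have -> : (fun s : R => h (y + s *: v)) =
    (fun s : R => F (T *m y + s *: (T *m v))) + (horner q).
  apply/funext => s; rewrite lyapunov_line -/a -/b -/c.
  by rewrite !fctE /q !hornerE /=; congr (_ + _ * (_ + _ + _)); ring.
apply: is_derive_eq.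
  by apply: is_deriveD; exact: is_derive_line.
rewrite /q derivZ !derivD derivC !derivZ derivX derivXn !hornerE /= scale0r addr0.
rewrite /a dotvZl [dotv (T *m (_ - _)) _]T_adj /g !dotvBl dotvZl.
by field; rewrite gt_eqF.
Qed.

(** With [d = g y - y], the descent lemma along [T d] cancels the terms linear in [d] and leaves
    [(L / 2) p - (p + q) / (2 alpha)], where [p = |T d|^2 <= q = <d, T d>] and [L <= 1 / alpha]. *)
Lemma lyapunov_descent y :
  h (g y) <= h y - 1 / (2 * alpha) * enorm (T *m (g y - y)) ^+ 2.
Proof.
set d := g y - y.
have gE : grad F (T *m y) = alpha^-1 *: (T *m y - y - d).
  apply/colP => i; rewrite /d /g !mxE; field; exact: lt0r_neq0.
have -> : h (g y) = h (y + 1 *: d) by rewrite scale1r /d addrC subrK.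
have -> : h y = h (y + 0 *: d) by rewrite scale0r addr0.
clearbody d; rewrite !lyapunov_line scale1r scale0r addr0.
have := descent_lemma (T *m y) (T *m d) F_diff F_lip.
rewrite gE dotvZl !dotvBl enorm_sqr.
have := T_contr d; have := dotv_ge0 (T *m d).
set p := dotv (T *m d) (T *m d); set q := dotv d (T *m d).
have ai : 0 < alpha^-1 by rewrite invr_gt0.
have aL : L <= alpha^-1 by rewrite -[leRHS]mulr1 ler_pdivlMl// ltW.
move=> p0 pq H.
have -> : 1 / (2 * alpha) = alpha^-1 / 2 by field; exact: lt0r_neq0.
have H1 : L / 2 * p <= alpha^-1 / 2 * p by rewrite ler_wpM2r// ler_wpM2r.
have H2 : alpha^-1 / 2 * p <= alpha^-1 / 2 * q by rewrite ler_wpM2l// ltW// divr_gt0.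
lra.
Qed.

Lemma grad_lyapunov_bound y : enorm (grad h y) <= alpha^-1 * enorm (g y - y).
Proof.
rewrite grad_lyapunov enormZ gtr0_norm ?invr_gt0// enormBC.
by rewrite ler_wpM2l ?T_le1// invr_ge0 ltW.
Qed.

Lemma continuous_lyapunov : continuous h.
Proof.
have -> : h = fun y => F (T *m y) + 1 / (2 * alpha) * dotv y (T *m y)
    - 1 / (2 * alpha) * dotv y ((T *m T) *m y).
  by apply/funext => y; rewrite /h mulmxA.
have cZ M (c : R) : continuous (fun y => c * dotv y (M *m y)).
  move=> x; apply: (@continuousM _ _ (cst c) (fun y => dotv y (M *m y))).
    exact: cst_continuous.
  exact: continuous_quadratic.
have cF : continuous (fun y => F (T *m y)).
  move=> x; apply: (@continuous_comp _ _ _ (fun y => T *m y) F).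
    exact: continuous_mulmx.
  exact: differentiable_continuous.
by move=> x; exact: (continuousB (continuousD (cF x) (cZ T _ x)) (cZ (T *m T) _ x)).
Qed.

Lemma dgd_step_diff y z : g y - g z =
  T *m (y - z) - alpha *: (grad F (T *m y) - grad F (T *m z)).
Proof. by rewrite /g mulmxBr scalerBr !opprB addrACA [RHS]addrACA [- _ + _]addrC. Qed.

Lemma dgd_step_lip y z : enorm (g y - g z) <= 2 * enorm (y - z).
Proof.
rewrite dgd_step_diff; apply: le_trans (ler_enormB _ _) _.
rewrite enormZ gtr0_norm//.
have := F_lip (T *m y) (T *m z); rewrite -mulmxBr -(ler_pM2l alpha_gt0) mulrA.
have := T_le1 (y - z).
have : alpha * L * enorm (T *m (y - z)) <= 1 * enorm (T *m (y - z)).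
  by rewrite ler_wpM2r ?enorm_ge0// ltW.
lra.
Qed.

(** The gradient term takes away at most the fraction [alpha * L < 1] of [|T (y - z)|], and [T] is
    invertible. *)
Lemma dgd_step_expansive :
  exists2 c, 0 < c & forall y z, c * enorm (y - z) <= enorm (g y - g z).
Proof.
have [c c0 Hc] := unitmx_enorm_bound T_unit.
exists ((1 - alpha * L) * c); first by rewrite mulr_gt0// subr_gt0.
move=> y z; rewrite dgd_step_diff; apply: le_trans (lerB_enorm _ _).
rewrite enormZ gtr0_norm//.
have := F_lip (T *m y) (T *m z); rewrite -mulmxBr -(ler_pM2l alpha_gt0) mulrA.
have : (1 - alpha * L) * (c * enorm (y - z)) <= (1 - alpha * L) * enorm (T *m (y - z)).
  by rewrite ler_wpM2l// subr_ge0 ltW.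
lra.
Qed.

Lemma dgd_converges y0 : coercive F -> KL_function h ->
  exists2 x, iter k g y0 @[k --> \oo] --> x & g x = x.
Proof.
move=> cF KLh.
have [c c0 Hc] := unitmx_enorm_bound T_unit.
pose y k := iter k g y0.
have hS k : h (y k.+1) <= h (y k).
  apply: le_trans (lyapunov_descent _) _.
  by rewrite gerBl mulr_ge0 ?sqr_ge0// divr_ge0 ?mulr_ge0 ?ltW.
have h0 k : h (y k) <= h y0 by elim: k => // k; exact: le_trans (hS k).
have [r Hr] := coercive_sublevel_bounded (h y0) cF.
(* [h y >= F (T y)] because [T^2 <= T]; so coercivity of [F] bounds [T y_k], and invertibility of
   [T] bounds [y_k]. *)
have yr k : enorm (y k) <= r / c.
  rewrite ler_pdivlMr// mulrC; apply: le_trans (Hc _) _; apply: Hr.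
  apply: le_trans (h0 k); rewrite /h -addrA lerDl -mulrBr mulr_ge0//.
    by rewrite divr_ge0// mulr_ge0// ltW.
  by rewrite -[dotv _ (T *m (T *m _))]T_adj subr_ge0 T_contr.
have a0 : 0 < c ^+ 2 / (2 * alpha) by rewrite divr_gt0 ?exprn_gt0// mulr_gt0.
have ai : 0 < alpha^-1 by rewrite invr_gt0.
have [|k|x yx] := KL_convergence continuous_lyapunov KLh a0 ai yr.
- move=> k; apply: le_trans (lyapunov_descent _) _; rewrite lerD2l lerN2.
  rewrite mul1r mulrAC mulrC ler_wpM2l ?invr_ge0 ?mulr_ge0 ?(ltW alpha_gt0)// -exprMn.
  by rewrite lerXn2r ?nnegrE ?mulr_ge0 ?enorm_ge0// ltW.
- exact: grad_lyapunov_bound.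
exists x => //; apply/eqP; rewrite -subr_eq0; apply/eqP/enorm_eq0/eqP.
(* The factor 3 is 2 from the Lipschitz constant of [g] between [x] and [y K], plus 1 from the
   distance of [y K.+1] to [x]. *)
rewrite eq_le enorm_ge0 andbT; apply: (@eps_bound _ _ _ 3) => // e e0.
rewrite add0r; have [K HK] := (cvg_enormP _ _).1 yx e e0.
apply: le_trans (ler_enorm_dist _ (g (y K)) _) _.
have := dgd_step_lip x (y K); rewrite [enorm (x - _)]enormBC.
have := HK K (leqnn K); have := HK K.+1 (leqnSn K).
by rewrite /y /=; lra.
Qed.

End Lyapunov.
(** * Repulsion from saddle points *)

Section Repulsion.
Context {R : realType} {N : nat}.
Implicit Types (u v w x y z : 'cV[R]_N) (M : 'M[R]_N).

Lemma strict_diff_lipschitz Phi x M (L : R) : strict_diff Phi x M -> 0 <= L ->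
  (forall y z, enorm (Phi y - Phi z) <= L * enorm (y - z)) ->
  forall v, enorm (M *m v) <= L * enorm v.
Proof.
move=> HM L0 HL v; apply: (@eps_bound _ _ _ (enorm v)); first exact: enorm_ge0.
move=> e e0; have [d d0 Hd] := HM e e0.
have v1 : 0 < enorm v + 1 by rewrite ltr_wpDl// enorm_ge0.
pose s := d / 2 / (enorm v + 1).
have s0 : 0 < s by rewrite divr_gt0// divr_gt0.
have sd : enorm (s *: v) < d.
  rewrite enormZ gtr0_norm//; apply: (@le_lt_trans _ _ (s * (enorm v + 1))).
    by rewrite ler_wpM2l ?lerDl// ltW.
  by rewrite /s divfK ?gt_eqF//; lra.
have xs : x + s *: v - x = s *: v by rewrite addrAC subrr add0r.
have := Hd (x + s *: v) x; rewrite xs subrr enorm0 => /(_ sd d0).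
have := HL (x + s *: v) x; rewrite xs -scalemxAr.
set P := Phi _ - Phi _ => H1 H2.
have := lerB_enorm (s *: (M *m v)) P; rewrite [enorm (_ - P)]enormBC.
move: H1 H2; rewrite !enormZ gtr0_norm// => H1 H2 H3.
rewrite -(ler_pM2l s0).
lra.
Qed.

(** The characteristic polynomial has fewer roots than its size, whereas the points [c k] are
    pairwise distinct. *)
Lemma exists_non_eigenvalue M (a b : R) : a < b ->
  exists2 c, a < c < b & M - c%:M \in unitmx.
Proof.
move=> ab; pose c (k : nat) := a + (b - a) / k.+2%:R.
have cab k : a < c k < b.
  rewrite /c ltrDl divr_gt0 ?subr_gt0//= -ltrBrDl ltr_pdivrMr//.
  by rewrite ltr_pMr ?subr_gt0// ltr1n.
have [k] : exists k, M - (c k)%:M \in unitmx.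
  apply: contrapT => /forallNP H.
  have Hroot k : root (char_poly M) (c k).
    rewrite -eigenvalue_root_char /eigenvalue /eigenspace kermx_eq0 row_free_unit.
    exact/negP/H.
  have := @max_poly_roots _ (char_poly M) (map c (iota 0 (size (char_poly M)))).
  rewrite monic_neq0 ?char_poly_monic// size_map size_iota ltnn => /(_ isT) H'.
  suff : false by [].
  apply: H'; first by apply/allP => _ /mapP[k _ ->].
  rewrite map_inj_uniq ?iota_uniq// => i j /addrI /(mulfI _) /= E.
  have /E /invr_inj /eqP : b - a != 0 by rewrite gt_eqF// subr_gt0.
  by rewrite eqr_nat => /eqP[].
by exists (c k).
Qed.

(* If [T A] is symmetric, [Q d = <d, T (A - theta) d>] satisfies
   [Q (A d) - theta^2 Q d = <w, T (A + theta) w>] with [w = (A - theta) d]. *)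
Lemma cone_expansion (T A : 'M[R]_N) (theta : R) : T^T = T ->
  (T *m A)^T = T *m A -> (forall w, 0 <= dotv w ((T *m A) *m w)) ->
  (forall x, dotv (T *m x) (T *m x) <= dotv x (T *m x)) -> T \in unitmx ->
  0 < theta -> A - theta%:M \in unitmx ->
  let B := T *m A - theta *: T in
  exists2 eta, 0 < eta & forall d e, enorm e <= eta * enorm d ->
    theta ^+ 2 * dotv d (B *m d) <= dotv (A *m d + e) (B *m (A *m d + e)).
Proof.
move=> TT TAT TA0 Tc Tu th0 Au B.
have BT : B^T = B by rewrite /B linearB linearZ /= TAT TT.
have [c1 c10 Hc1] := unitmx_enorm_bound Tu.
have [c2 c20 Hc2] := unitmx_enorm_bound Au.
have [C1 C10 HC1] := mulmx_enorm_bound (B *m A).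
have [C2 C20 HC2] := mulmx_enorm_bound B.
(* From [<w, T w> >= |T w|^2 >= (c1 c2 |d|)^2]: the strict gain that absorbs the perturbation
   [e]. *)
pose delta := theta * (c1 * c2) ^+ 2.
have delta0 : 0 < delta by rewrite mulr_gt0// exprn_gt0// mulr_gt0.
have key d : theta ^+ 2 * dotv d (B *m d) + delta * enorm d ^+ 2
    <= dotv (A *m d) (B *m (A *m d)).
  pose w := (A - theta%:M) *m d.
  have wE : w = A *m d - theta *: d by rewrite /w mulmxBl mul_scalar_mx.
  have E : dotv (A *m d) (B *m (A *m d)) = theta ^+ 2 * dotv d (B *m d)
      + dotv w ((T *m A) *m w) + theta * dotv w (T *m w).
    have Bz z : B *m z = T *m (A *m z) - theta *: (T *m z).
      by rewrite /B mulmxBl -mulmxA -scalemxAl.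
    have Mw M : M *m w = M *m (A *m d) - theta *: (M *m d).
      by rewrite wE mulmxBr -scalemxAr.
    have E1 : dotv d (T *m (A *m (A *m d))) = dotv (A *m d) (T *m (A *m d)).
      by rewrite mulmxA dotv_sym// -mulmxA.
    rewrite !Bz !Mw -!mulmxA wE !(dotvBl, dotvBr, dotvZl, dotvZr) E1.
    rewrite (dotv_sym (A *m d) d TT).
    ring.
  rewrite E -addrA lerD2l -[leLHS]add0r lerD//.
  rewrite /delta -mulrA ler_wpM2l ?(ltW th0)//.
  apply: le_trans (Tc w); rewrite -enorm_sqr -exprMn.
  rewrite lerXn2r ?nnegrE ?mulr_ge0 ?enorm_ge0 ?(ltW c10) ?(ltW c20)//.
  by apply: le_trans (Hc1 _); rewrite -mulrA ler_wpM2l ?(ltW c10)// Hc2.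
(* The cross terms cost [2 C1 eta |d|^2] and the square term [C2 eta^2 |d|^2]; [eta <= 1] makes the
   latter linear in [eta]. *)
pose eta := Num.min 1 (delta / (2 * C1 + C2)).
have C0 : 0 < 2 * C1 + C2 by rewrite addr_gt0// mulr_gt0.
have eta0 : 0 < eta by rewrite lt_min ltr01 divr_gt0.
have eta1 : eta <= 1 by rewrite ge_min lexx.
have etaC : eta * (2 * C1 + C2) <= delta by rewrite -ler_pdivlMr// ge_min lexx orbT.
exists eta => // d e ed.
have D0 := enorm_ge0 d; have e0 := enorm_ge0 e.
rewrite mulmxDr !dotvDl !dotvDr (dotv_sym (A *m d) e BT).
have H1 : - (C1 * eta * enorm d ^+ 2) <= dotv e (B *m (A *m d)).
  have : `|dotv e (B *m (A *m d))| <= (eta * enorm d) * (C1 * enorm d).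
    apply: le_trans (ler_norm_dotv _ _) _; apply: ler_pM => //; first exact: enorm_ge0.
    by rewrite mulmxA HC1.
  by rewrite ler_norml => /andP[+ _]; apply: le_trans; rewrite lerN2; lra.
have H2 : - (C2 * eta * enorm d ^+ 2) <= dotv e (B *m e).
  have : `|dotv e (B *m e)| <= (eta * enorm d) * (C2 * (eta * enorm d)).
    apply: le_trans (ler_norm_dotv _ _) _; apply: ler_pM => //; first exact: enorm_ge0.
    by apply: le_trans (HC2 _) _; rewrite ler_wpM2l// ltW.
  rewrite ler_norml => /andP[+ _]; apply: le_trans; rewrite lerN2.
  have -> : eta * enorm d * (C2 * (eta * enorm d)) = eta * (C2 * eta * enorm d ^+ 2) by ring.
  by rewrite ler_piMl// !mulr_ge0 ?sqr_ge0// ltW.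
have H3 : eta * (2 * C1 + C2) * enorm d ^+ 2 <= delta * enorm d ^+ 2.
  by rewrite ler_wpM2r// sqr_ge0.
have := key d; lra.
Qed.

Variables (T : 'M[R]_N) (F : 'cV[R]_N -> R) (L alpha : R).
Hypothesis T_sym : T^T = T.
Hypothesis T_contr : forall x, dotv (T *m x) (T *m x) <= dotv x (T *m x).
Hypothesis T_unit : T \in unitmx.
Hypothesis alpha_gt0 : 0 < alpha.
Hypothesis L_gt0 : 0 < L.
Hypothesis alphaL_lt1 : alpha * L < 1.
Hypothesis F_C2 : C2 F.
Hypothesis F_lip : forall y z, enorm (grad F y - grad F z) <= L * enorm (y - z).

Local Notation g := (dgd_step T F alpha).
Local Notation h := (dgd_lyapunov T F alpha).

Let F_diff : forall y, differentiable F y := proj1 (proj1 F_C2).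

Definition dgd_jacobian x := T - alpha *: ((hessian F (T *m x))^T *m T).

Lemma strict_diff_dgd_step x : strict_diff g x (dgd_jacobian x).
Proof.
move=> e e0; have [d d0 Hd] := strict_diff_grad (T *m x) F_C2 (divr_gt0 e0 alpha_gt0).
exists d => // y z yx zx.
have Tle v := T_le1 T_contr v.
have -> : g y - g z - dgd_jacobian x *m (y - z) = - (alpha *: (grad F (T *m y)
    - grad F (T *m z) - (hessian F (T *m x))^T *m (T *m y - T *m z))).
  rewrite dgd_step_diff mulmxBl -scalemxAl -mulmxA -mulmxBr.
  by rewrite [in RHS]scalerBr opprB opprB addrC addrA subrK.
rewrite enormN enormZ gtr0_norm//.
rewrite -ler_pdivlMl// mulrA [_^-1 * _]mulrC.
apply: le_trans (Hd _ _ _ _) _; rewrite -?mulmxBr.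
- exact: le_lt_trans (Tle _) yx.
- exact: le_lt_trans (Tle _) zx.
- by rewrite ler_wpM2l// divr_ge0 ?ltW.
Qed.

Lemma hessian_sym x : (hessian F x)^T = hessian F x.
Proof.
have /(strict_diff_grad_sym F_diff) := strict_diff_grad x F_C2.
by rewrite trmxK.
Qed.

Lemma jacobian_sym x : (T *m dgd_jacobian x)^T = T *m dgd_jacobian x.
Proof.
rewrite /dgd_jacobian mulmxBr -scalemxAr linearB linearZ /= !trmx_mul trmxK.
by rewrite T_sym !mulmxA hessian_sym.
Qed.

(** The map [grad h], that is [T (y - g y) / alpha], inherits strict differentiability from [g];
    symmetry of the result removes the transpose of [strict_diff_hessian]. *)
Lemma hessian_lyapunov x :
  hessian h x = alpha^-1 *: (T - T *m dgd_jacobian x).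
Proof.
rewrite (@strict_diff_hessian _ _ _ _ (alpha^-1 *: (T - T *m dgd_jacobian x))).
  by rewrite linearZ linearB /= jacobian_sym T_sym.
move=> e e0.
have [d d0 Hd] := strict_diff_dgd_step x (mulr_gt0 alpha_gt0 e0).
exists d => // y z yx zx; have := Hd _ _ yx zx.
rewrite !grad_lyapunov// -scalemxAl -!scalerBr enormZ gtr0_norm ?invr_gt0//.
rewrite ler_pdivrMl// mulrA; apply: le_trans; apply: le_trans (T_le1 T_contr _).
rewrite mulmxBl -mulmxA; set w := dgd_jacobian x *m (y - z).
rewrite -!mulmxBr -enormN -mulmxN.
rewrite le_eqVlt; apply/orP; left; apply/eqP; congr (enorm (T *m _)).
move: (g y) (g z) w => gy gz w.
by apply/colP => i; rewrite !mxE; ring.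
Qed.

(** With [u = T w] and [H] the Hessian of [F] at [T x], the form equals [|u|^2 - alpha <u, H u>], at
    least [(1 - alpha L) |u|^2]. *)
Lemma jacobian_psd x w : 0 <= dotv w ((T *m dgd_jacobian x) *m w).
Proof.
rewrite -mulmxA -T_adj// /dgd_jacobian mulmxBl -scalemxAl -mulmxA.
set u := T *m w; rewrite dotvBr dotvZr.
have := strict_diff_lipschitz (strict_diff_grad (T *m x) F_C2) (ltW L_gt0) F_lip u.
set Hu := _ *m u => H.
have H1 : alpha * dotv u Hu <= alpha * (enorm u * (L * enorm u)).
  rewrite ler_wpM2l ?(ltW alpha_gt0)//; apply: le_trans (ler_dotv _ _) _.
  by rewrite ler_wpM2l// enorm_ge0.
have H2 : alpha * L * dotv u u <= 1 * dotv u u.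
  by rewrite ler_wpM2r ?dotv_ge0// ltW.
move: H1 H2; rewrite -enorm_sqr; lra.
Qed.

(** A positive value of [Q] at [y - z] would grow without bound along the two orbits, although they
    stay within [2 d] of each other. *)
Lemma saddle_repulsion x : ~ possemidef (hessian h x) ->
  exists d (B : 'M[R]_N) v, [/\ 0 < d, 0 < dotv v (B *m v) &
    forall y z, (forall k, enorm (iter k g y - x) < d) ->
      (forall k, enorm (iter k g z - x) < d) -> dotv (y - z) (B *m (y - z)) <= 0].
Proof.
have hT : (hessian h x)^T = hessian h x.
  by rewrite hessian_lyapunov linearZ linearB /= jacobian_sym T_sym.
move=> /not_andP[//|/existsNP[v /negP]]; rewrite -ltNge.
set A := dgd_jacobian x.
rewrite hessian_lyapunov -scalemxAl dotvZr pmulr_rlt0 ?invr_gt0// mulmxBl dotvBr subr_lt0 => hv.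
have Tv0 : 0 <= dotv v (T *m v) by apply: le_trans (T_contr v); exact: dotv_ge0.
have Tv1 : 0 < dotv v (T *m v) + 1 by rewrite ltr_wpDl.
(* Any [theta] in [(1, b)] keeps [<v, T A v> - theta <v, T v>] positive; the [+ 1] keeps the
   denominator positive. *)
pose b := 1 + (dotv v ((T *m A) *m v) - dotv v (T *m v)) / (dotv v (T *m v) + 1).
have b1 : 1 < b by rewrite ltrDl divr_gt0// subr_gt0.
have [theta /andP[th1 thb] Au] := exists_non_eigenvalue A b1.
have th0 : 0 < theta := lt_trans ltr01 th1.
have [eta eta0 Heta] :=
  cone_expansion T_sym (jacobian_sym x) (jacobian_psd x) T_contr T_unit th0 Au.
set B := _ - _ in Heta.
have [d d0 Hd] := strict_diff_dgd_step x eta0.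
exists d, B, v; split => //.
  rewrite /B mulmxBl dotvBr -scalemxAl dotvZr subr_gt0.
  move: thb; rewrite /b -ltrBlDl ltr_pdivlMr// => thb.
  have : (theta - 1) * dotv v (T *m v) <= (theta - 1) * (dotv v (T *m v) + 1).
    by rewrite ler_wpM2l ?lerDl// subr_ge0 ltW.
  lra.
move=> y z Hy Hz; rewrite leNgt; apply/negP => Q0.
pose D k := iter k g y - iter k g z.
have th2 : 0 < theta ^+ 2 - 1 by rewrite subr_gt0 exprn_egt1.
set q := dotv _ _ in Q0.
(* Bernoulli's lower bound for [theta^(2 k)]; linear growth already contradicts boundedness. *)
have Qk k : q * (1 + k%:R * (theta ^+ 2 - 1)) <= dotv (D k) (B *m D k).
  elim: k => [|k IH]; first by rewrite mul0r addr0 mulr1.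
  have := Hd _ _ (Hy k) (Hz k); set e := _ - _ => eD.
  have -> : D k.+1 = A *m D k + e by rewrite /e addrC subrK.
  apply: le_trans (Heta _ _ eD).
  apply: le_trans (_ : theta ^+ 2 * (q * (1 + k%:R * (theta ^+ 2 - 1))) <= _).
    rewrite mulrCA ler_pM2l// -natr1.
    have : 0 <= k%:R * (theta ^+ 2 - 1) * (theta ^+ 2 - 1) by rewrite !mulr_ge0// ltW.
    lra.
  by rewrite ler_wpM2l ?sqr_ge0.
have [C C0 HC] := mulmx_enorm_bound B.
have Qb k : dotv (D k) (B *m D k) <= C * (2 * d) ^+ 2.
  have Dk : enorm (D k) <= 2 * d.
    apply: le_trans (ler_enorm_dist _ x _) _; rewrite [enorm (x - _)]enormBC.
    have := Hy k; have := Hz k; lra.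
  apply: le_trans (ler_dotv _ _) _; rewrite expr2 mulrCA.
  apply: ler_pM; rewrite ?enorm_ge0//.
  by apply: le_trans (HC _) _; rewrite ler_wpM2l// ltW.
pose X := C * (2 * d) ^+ 2 / q / (theta ^+ 2 - 1).
have [k Xk] : exists k : nat, X < k%:R.
  by exists (Num.trunc X).+1; exact: truncnS_gt.
have := le_trans (Qk k) (Qb k); apply/negP; rewrite -ltNge.
move: Xk; rewrite /X ltr_pdivrMr// ltr_pdivrMr// => Xk.
by apply: lt_trans Xk _; rewrite mulrC ltr_pM2l// ltrDr.
Qed.

End Repulsion.
(** * Lipschitz graphs are null sets *)

Section ThinSets.
Context {R : realType} {N : nat}.
Implicit Types (x y z p : 'cV[R]_N) (S A : set 'cV[R]_N).

Lemma closed_box (a b : 'cV[R]_N) : closed (box a b).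
Proof.
have -> : box a b = \bigcap_i [set x : 'cV[R]_N | x i 0 \in `[a i 0, b i 0]].
  apply/seteqP; split=> [x xab i _ /=|x xab i]; first by rewrite in_itv /= xab.
  by have := xab i Logic.I; rewrite /= in_itv.
apply: closed_bigI => i _.
apply: (closed_comp (f := fun x : 'cV[R]_N => x i 0) (D := `[a i 0, b i 0]%classic)).
  by move=> x _; exact: coord_continuous.
exact: interval_closed.
Qed.

Lemma measurable_box (a b : 'cV[R]_N) : measurable (box a b : set (borel_cV R N)).
Proof.
rewrite -[box a b]setCK; apply: measurableC; apply: sub_sigma_algebra.
exact/closed_openC/closed_box.
Qed.

Definition box_cover (a b : nat -> 'cV[R]_N) S :=
  (forall k i, a k i 0 <= b k i 0) /\ S `<=` \bigcup_k box (a k) (b k).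

Definition box_volume (a b : nat -> 'cV[R]_N) : \bar R :=
  (\sum_(0 <= k <oo) (\prod_i (b k i 0 - a k i 0))%:E)%E.

(** [S] is an arbitrary set, so it is enclosed in a Borel one: the intersection over [m] of covers
    of volume at most [1 / (m + 1)]. *)
Lemma negligible_box_cover (P : probability (borel_cV R N) R) S :
  P `<< @lebesgue_cV R N ->
  (forall e, 0 < e -> exists a b, box_cover a b S /\ (box_volume a b <= e%:E)%E) ->
  P.-negligible (S : set (borel_cV R N)).
Proof.
move=> PL H.
have {}H (m : nat) : exists ab : (nat -> 'cV[R]_N) * (nat -> 'cV[R]_N),
    box_cover ab.1 ab.2 S /\ (box_volume ab.1 ab.2 <= (m.+1%:R^-1)%:E)%E.
  by have [|a [b Hab]] := H m.+1%:R^-1; [rewrite invr_gt0|exists (a, b)].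
have [ab Hab] := choice H.
pose A : set (borel_cV R N) := \bigcap_m \bigcup_k box ((ab m).1 k) ((ab m).2 k).
have mA : measurable A.
  by apply: bigcapT_measurable => m; apply: bigcupT_measurable => k; exact: measurable_box.
exists A; split => //; last by move=> x Sx m _; exact: (proj2 (proj1 (Hab m))).
apply: (PL A) => // B mB BA; apply/eqP; rewrite eq_le; apply/andP; split; last first.
  apply: le_ereal_inf_tmp => _ [a [b [ab0 _ ->]]].
  by apply: nneseries_ge0 => k _ _; rewrite lee_fin prodr_ge0// => i _; rewrite subr_ge0.
apply/lee_addgt0Pr => e e0; rewrite add0e.
have [m me] : exists m : nat, m.+1%:R^-1 <= e.
  exists (Num.trunc e^-1); rewrite -[leRHS]invrK lef_pV2 ?posrE ?invr_gt0//.
  exact/ltW/truncnS_gt.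
apply: le_trans (_ : (m.+1%:R^-1)%:E <= _)%E; last by rewrite lee_fin.
have [[ab0 _] vol] := Hab m; apply: le_trans vol.
apply: ereal_inf_lbound; exists (ab m).1, (ab m).2; split => //.
by move=> x /BA Ax; exact: Ax.
Qed.

Lemma cube_cover (I : finType) (p : I -> 'cV[R]_N) (r : R) : (0 < N)%N -> 0 <= r ->
  exists a b, box_cover a b [set x | exists c, forall j, `|x j 0 - p c j 0| <= r] /\
    box_volume a b = (#|I|%:R * (2 * r) ^+ N)%:E.
Proof.
move=> N0 r0.
(* Indices from [#|I|] on get the degenerate box at 0, whose volume vanishes because [N > 0]. *)
pose q (s : R) k :=
  if insub k : option 'I_#|I| is Some c then p (enum_val c) + const_mx s else 0.
exists (q (- r)), (q r); split.
  split=> [k i|x [c Hc]].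
    by rewrite /q; case: insubP => [j _ _|_]; rewrite !mxE// lerD2l; lra.
  exists (enum_rank c) => // j; rewrite /q !valK /= !mxE enum_rankK.
  by have := Hc j; rewrite ler_norml => /andP[]; lra.
rewrite /box_volume (@nneseries_split _ _ 0 #|I|); last first.
  move=> k _; rewrite lee_fin prodr_ge0// => i _; rewrite /q subr_ge0.
  by case: insubP => [j _ _|_]; rewrite !mxE// lerD2l; lra.
rewrite add0n eseries0 ?adde0; last first.
  move=> k Ik _; rewrite (bigD1 (Ordinal N0))//= /q insubN -?leqNgt//.
  by rewrite !mxE subrr mul0r.
rewrite big_mkord (eq_bigr (fun=> ((2 * r) ^+ N)%:E)) => [|k _].
  by rewrite sumEFin sumr_const card_ord -[_ *+ #|I|]mulr_natl.
rewrite (eq_bigr (fun=> 2 * r)) => [|i _]; last by rewrite /q !valK /= !mxE; ring.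
by rewrite prodr_const card_ord.
Qed.

(* [phi], restricted to the coordinates other than [i], is a chart of [S] into
   a bounded subset of a space of dimension [N - 1] whose inverse is Lipschitz;
   [(m+1)^(N-1)] cubes of side [O(1/m)] then cover [S]. *)
Lemma negligible_lipschitz_chart (P : probability (borel_cV R N) R) S
    (i : 'I_N) (phi : 'cV[R]_N -> 'I_N -> R) (C r : R) :
  P `<< @lebesgue_cV R N -> 0 <= C ->
  (forall y j, S y -> `|phi y j| <= r) ->
  (forall y z s, S y -> S z -> 0 <= s ->
     (forall j, j != i -> `|phi y j - phi z j| <= s) -> enorm (y - z) <= C * s) ->
  P.-negligible (S : set (borel_cV R N)).
Proof.
move=> PL C0 phir HC; apply: negligible_box_cover => // e e0.
have N0 : (0 < N)%N by apply: leq_ltn_trans (ltn_ord i).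
pose J := {j : 'I_N | j != i}.
have cardJ : #|{: J}| = N.-1 by rewrite card_sig -[N in RHS]card_ord -(cardC1 i).
pose r' := `|r| + 1; have r'0 : 0 < r' by rewrite ltr_wpDl.
pose K := 2 ^+ N.-1 * (2 * (C * (2 * r'))) ^+ N.
have K0 : 0 <= K by rewrite mulr_ge0 ?exprn_ge0// !mulr_ge0// ltW.
(* At most [(2 m)^(N-1)] cubes of side [2 s], with [s] of order [1 / m], have total volume at most
   [K / m], hence at most [e]. *)
pose m := (Num.trunc (K / e)).+1.
have m0 : 0 < m%:R :> R by rewrite ltr0n.
have Km : K / m%:R <= e.
  rewrite ler_pdivrMr// mulrC -ler_pdivrMr// ltW//; exact: truncnS_gt.
(* Index of the subinterval of [[-r', r']], of length [2 r' / m], containing [x]; the right endpoint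
   takes the extra index [m]. *)
pose idx (x : R) : 'I_m.+1 := inord (Num.trunc ((x + r') / (2 * r') * m%:R)).
have idxP (x x' : R) : `|x| <= r -> `|x'| <= r -> idx x = idx x' ->
    `|x - x'| <= 2 * r' / m%:R.
  have pos (w : R) : `|w| <= r -> 0 <= (w + r') / (2 * r') * m%:R < m.+1%:R.
    move=> wr; have : `|w| <= r' by rewrite (le_trans wr)// /r' ler_wpDr// ler_norm.
    rewrite ler_norml => /andP[w1 w2]; apply/andP; split.
      rewrite mulr_ge0// divr_ge0//; lra.
    rewrite (@le_lt_trans _ _ m%:R) ?ltr_nat//.
    rewrite ler_piMl// ler_pdivrMr; lra.
  move=> /pos /andP[p1 p2] /pos /andP[q1 q2] /(congr1 val) /=.
  rewrite !inordK ?truncn_lt_nat// => E.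
  have := truncn_itv p1; have := truncn_itv q1; rewrite -E -natr1.
  set a := _ * m%:R; set b := _ * m%:R; move=> /andP[a1 a2] /andP[b1 b2].
  have ab : `|a - b| <= 1 by rewrite ler_norml; apply/andP; split; lra.
  have -> : x - x' = (a - b) * (2 * r' / m%:R).
    by rewrite /a /b; field; rewrite !gt_eqF.
  rewrite normrM [X in _ * X]gtr0_norm ?divr_gt0 ?mulr_gt0//.
  by rewrite ler_piMl// divr_ge0 ?mulr_ge0// ltW.
pose cell y : {ffun J -> 'I_m.+1} := [ffun j => idx (phi y (val j))].
(* A representative in [S] of each cell; 0 if the cell does not meet [S]. *)
pose p c := xget 0 [set y | S y /\ cell y = c].
pose s := C * (2 * r' / m%:R).
have s0 : 0 <= s by rewrite mulr_ge0// divr_ge0 ?mulr_ge0// ltW.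
have [a [b [[ab0 cov] vol]]] := cube_cover p N0 s0.
exists a, b; split.
  split => // y Sy; apply: cov; exists (cell y) => j.
  have [Sp cp] : S (p (cell y)) /\ cell (p (cell y)) = cell y.
    by rewrite /p; case: xgetP => [z _ //|/(_ y)]; case.
  have -> : y j 0 - p (cell y) j 0 = (y - p (cell y)) j 0 by rewrite !mxE.
  apply: le_trans (ler_coord_enorm _ _) _; apply: HC => //.
    by rewrite divr_ge0 ?mulr_ge0// ltW.
  move=> k ki; apply: idxP; [exact: phir|exact: phir|].
  by have /ffunP/(_ (exist _ k ki)) := cp; rewrite !ffunE.
rewrite vol lee_fin; apply: le_trans Km.
rewrite card_ffun card_ord cardJ natrX.
apply: (@le_trans _ _ ((2 * m%:R) ^+ N.-1 * (2 * s) ^+ N)).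
  apply: ler_wpM2r; first by rewrite exprn_ge0// mulr_ge0//.
  rewrite lerXn2r ?nnegrE ?mulr_ge0//.
  by rewrite -natrM ler_nat mul2n -addnn -addn1 leq_add2l.
have -> : 2 * s = 2 * (C * (2 * r')) / m%:R by rewrite /s; field; rewrite gt_eqF.
rewrite exprMn exprMn exprVn /K -[N in m%:R ^- N](prednK N0) exprSr.
rewrite le_eqVlt; apply/orP; left; apply/eqP; field.
by rewrite gt_eqF//= expf_neq0// gt_eqF.
Qed.
End ThinSets.
(** * Saddle avoidance *)

Section SaddleAvoidance.
Context {R : realType} {N : nat}.
Implicit Types (u v w x y z : 'cV[R]_N) (M : 'M[R]_N).

(** Write [d = t v + w] with [w i 0 = 0]. If [|t|] were large compared with [|w|], the term
    [t^2 <v, B v>] would dominate and make the form positive; so [w] controls [d]. *)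
Lemma indefinite_chart (B : 'M[R]_N) v : 0 < dotv v (B *m v) ->
  exists i C, [/\ v i 0 != 0, 0 <= C & forall d s, dotv d (B *m d) <= 0 -> 0 <= s ->
    (forall j, j != i -> `|(d - (d i 0 / v i 0) *: v) j 0| <= s) ->
    enorm d <= C * s].
Proof.
set q := dotv v _ => q0.
have [i vi] : exists i, v i 0 != 0.
  apply: contrapT => /forallNP H; move: q0; rewrite /q.
  suff -> : v = 0 by rewrite dotv0l ltxx.
  by apply/colP => i; rewrite mxE; apply/eqP/negPn/negP.
have [C C0 HC] := mulmx_enorm_bound B.
have v0 := enorm_ge0 v.
(* The quotient comes from [q t^2 <= (2 C |v| + C) |t| |w|], valid when [|w| <= |t|]; the [+ 1]
   gives [M >= 1], which ensures this when [|t| > M |w|]. *)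
pose M := (2 * C * enorm v + C) / q + 1.
have C0' := ltW C0.
have M1 : 1 <= M by rewrite lerDr divr_ge0 ?(ltW q0)// addr_ge0// !mulr_ge0.
have M0 : 0 <= M := le_trans ler01 M1.
exists i, ((M * enorm v + 1) * N%:R); split => //.
  by rewrite mulr_ge0// addr_ge0// mulr_ge0.
move=> d s Qd s0 ds; set t := _ / _ in ds; set w := _ - _ in ds.
have wi : w i 0 = 0 by rewrite /w /t !mxE; field.
have dE : d = t *: v + w by rewrite /w addrC subrK.
clearbody w.
have ws : enorm w <= N%:R * s.
  apply: le_trans (ler_enorm_sum _) _; rewrite mulr_natl -[N in _ *+ N]card_ord -sumr_const.
  apply: ler_sum => j _; have [->|/ds//] := eqVneq j i.
  by rewrite wi normr0.
have w0 := enorm_ge0 w.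
have bil u u' : `|dotv u (B *m u')| <= C * (enorm u * enorm u').
  apply: le_trans (ler_norm_dotv _ _) _; rewrite mulrCA.
  by rewrite ler_wpM2l ?enorm_ge0.
have tw : `|t| <= M * enorm w.
  rewrite leNgt; apply/negP => tM.
  have t0 : 0 < `|t| by apply: le_lt_trans tM; rewrite mulr_ge0.
  have wt : enorm w <= `|t|.
    by apply/ltW/(le_lt_trans _ tM); rewrite ler_peMl.
  have H : q * `|t| ^+ 2 <= (2 * C * enorm v + C) * (`|t| * enorm w).
    move: Qd; rewrite dE mulmxDr !dotvDl !dotvDr -!scalemxAr !dotvZr !dotvZl -/q => Qd.
    have H1 : - (`|t| * (C * (enorm v * enorm w))) <= t * dotv v (B *m w).
      have : `|t * dotv v (B *m w)| <= `|t| * (C * (enorm v * enorm w)).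
        by rewrite normrM ler_wpM2l.
      by rewrite ler_norml => /andP[].
    have H2 : - (`|t| * (C * (enorm w * enorm v))) <= t * dotv w (B *m v).
      have : `|t * dotv w (B *m v)| <= `|t| * (C * (enorm w * enorm v)).
        by rewrite normrM ler_wpM2l.
      by rewrite ler_norml => /andP[].
    have H3 : - (C * (`|t| * enorm w)) <= dotv w (B *m w).
      have : `|dotv w (B *m w)| <= C * (`|t| * enorm w).
        apply: le_trans (bil _ _) _; rewrite ler_wpM2l ?(ltW C0)//.
        by rewrite ler_wpM2r.
      by rewrite ler_norml => /andP[].
    rewrite real_normK ?num_real//; lra.
  have : `|t| * (q * `|t|) <= `|t| * ((2 * C * enorm v + C) * enorm w) by lra.
  rewrite ler_pM2l// -ler_pdivlMl// mulrA [q^-1 * _]mulrC.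
  have : M * enorm w = (2 * C * enorm v + C) / q * enorm w + enorm w.
    by rewrite /M mulrDl mul1r.
  lra.
rewrite [d in enorm d]dE; apply: le_trans (ler_enormD _ _) _; rewrite enormZ.
apply: (@le_trans _ _ ((M * enorm v + 1) * enorm w)); last first.
  by rewrite -mulrA ler_wpM2l// addr_ge0// mulr_ge0.
rewrite mulrDl mul1r lerD2r [leRHS]mulrAC.
by rewrite ler_wpM2r.
Qed.

Lemma rat_dense_cV x (e : R) : 0 < e ->
  exists q : 'cV[rat]_N, enorm (map_mx ratr q - x) < e.
Proof.
move=> e0; pose e' := e / N.+1%:R.
have e'0 : 0 < e' by rewrite divr_gt0.
have H i : exists r : rat, `|ratr r - x i 0| < e'.
  have [|r] := @rat_in_itvoo R (x i 0 - e') (x i 0 + e').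
    by rewrite ltrD2l gtrN.
  rewrite in_itv /= => /andP[r1 r2]; exists r.
  by rewrite ltr_norml; apply/andP; split; lra.
have [r Hr] := choice H.
exists (\col_i r i); apply: le_lt_trans (ler_enorm_sum _) _.
apply: (@le_lt_trans _ _ (\sum_(i < N) e')).
  by apply: ler_sum => i _; rewrite !mxE ltW.
rewrite sumr_const card_ord -mulr_natl /e' mulrA ltr_pdivrMr// mulrC.
by rewrite ltr_pM2l// ltr_nat.
Qed.

Lemma negligible_countable (I : countType) (d : measure_display)
    (X : measurableType d) (P : probability X R) (S : I -> set X) :
  (forall i, P.-negligible (S i)) -> P.-negligible (\bigcup_i S i).
Proof.
move=> H.
apply: (@negligibleS _ _ _ _ (\bigcup_n if unpickle n is Some i then S i else set0)).
  by move=> y [i _ Siy]; exists (pickle i) => //; rewrite pickleK.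
apply: negligible_bigcup => n; case: unpickle => [i|]; first exact: H.
exact: negligible_set0.
Qed.

Variables (T : 'M[R]_N) (F : 'cV[R]_N -> R) (L alpha : R).
Hypothesis T_sym : T^T = T.
Hypothesis T_contr : forall x, dotv (T *m x) (T *m x) <= dotv x (T *m x).
Hypothesis T_unit : T \in unitmx.
Hypothesis alpha_gt0 : 0 < alpha.
Hypothesis L_gt0 : 0 < L.
Hypothesis alphaL_lt1 : alpha * L < 1.
Hypothesis F_C2 : C2 F.
Hypothesis F_lip : forall y z, enorm (grad F y - grad F z) <= L * enorm (y - z).

Local Notation g := (dgd_step T F alpha).
Local Notation h := (dgd_lyapunov T F alpha).

Lemma iter_expansive K :
  exists2 c, 0 < c & forall y z, c * enorm (y - z) <= enorm (iter K g y - iter K g z).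
Proof.
have [c c0 Hc] := dgd_step_expansive T_unit alpha_gt0 alphaL_lt1 F_lip.
exists (c ^+ K); first by rewrite exprn_gt0.
move=> y z; elim: K => [|K IH]; first by rewrite mul1r.
by apply: le_trans (Hc _ _); rewrite exprS -mulrA ler_pM2l.
Qed.

(** The chart projects [g^K y] along [v]: bounded as [g^K y] is within [d] of [x], with inverse of
    Lipschitz constant [C / c], where [c] is the expansion factor of [g^K]. *)
Lemma negligible_trapped (P : probability (borel_cV R N) R) x (d : R) (B : 'M[R]_N) v K :
  P `<< @lebesgue_cV R N -> 0 < dotv v (B *m v) ->
  (forall y z, (forall k, enorm (iter k g y - x) < d) ->
      (forall k, enorm (iter k g z - x) < d) -> dotv (y - z) (B *m (y - z)) <= 0) ->
  P.-negligible ([set y | forall k, (K <= k)%N -> enorm (iter k g y - x) < d]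
    : set (borel_cV R N)).
Proof.
move=> PL q0 HB; have [i [C [vi C0 HC]]] := indefinite_chart q0.
have [c c0 Hc] := iter_expansive K.
pose pi u : 'cV[R]_N := u - (u i 0 / v i 0) *: v.
apply: (@negligible_lipschitz_chart _ _ _ _ i (fun y j => pi (iter K g y) j 0)
  (C / c) ((enorm x + d) * (1 + enorm v / `|v i 0|))) => //.
- by rewrite divr_ge0// ltW.
- move=> y j /(_ K (leqnn K)) yd.
  have yxd : enorm (iter K g y) <= enorm x + d.
    by rewrite -[iter K g y](subrK x) addrC (le_trans (ler_enormD _ _))// lerD2l ltW.
  apply: le_trans (ler_coord_enorm _ _) _; apply: le_trans (ler_enormB _ _) _.
  rewrite enormZ normrM normfV mulrDr mulr1 lerD// mulrA mulrAC.
  rewrite -!mulrA; apply: ler_pM => //; last 1 first.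
    exact: le_trans (ler_coord_enorm _ _) yxd.
  by rewrite mulr_ge0// ?enorm_ge0// invr_ge0.
- move=> y z s Hy Hz s0 Hs; rewrite mulrAC ler_pdivlMr// mulrC.
  apply: le_trans (Hc y z) _; apply: HC => //.
    by apply: HB => k; rewrite -iterD; [apply: Hy|apply: Hz]; rewrite leq_addl.
  move=> j /Hs; rewrite /pi => H; apply: le_trans H.
  rewrite le_eqVlt; apply/orP; left; apply/eqP; congr `|_|.
  by rewrite !mxE; ring.
Qed.

Lemma saddle_avoidance (P : probability (borel_cV R N) R) :
  P `<< @lebesgue_cV R N ->
  P.-negligible ([set y | exists2 x,
      iter k g y @[k --> \oo] --> x & ~ possemidef (hessian h x)] : set (borel_cV R N)).
Proof.
move=> PL.
(* A property of the ball alone, not of a saddle in it: possibly uncountably many saddles are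
   handled by countably many balls. *)
pose good (c : 'cV[R]_N) (d : R) := exists (B : 'M[R]_N) v, 0 < dotv v (B *m v) /\
  forall y z, (forall k, enorm (iter k g y - c) < d) ->
      (forall k, enorm (iter k g z - c) < d) -> dotv (y - z) (B *m (y - z)) <= 0.
pose ctr (q : 'cV[rat]_N) : 'cV[R]_N := map_mx ratr q.
pose S (a : 'cV[rat]_N * nat * nat) : set (borel_cV R N) :=
  [set y | good (ctr a.1.1) a.1.2.+1%:R^-1 /\
    forall k, (a.2 <= k)%N -> enorm (iter k g y - ctr a.1.1) < a.1.2.+1%:R^-1].
apply: (@negligibleS _ _ _ _ (\bigcup_a S a)); last first.
  apply: negligible_countable => -[[q m] K].
  have [[B [v [q0 HB]]]|ng] := pselect (good (ctr q) m.+1%:R^-1).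
    apply: negligibleS (negligible_trapped K PL q0 HB).
    by move=> y [_].
  rewrite (_ : S _ = set0); first exact: negligible_set0.
  by apply/seteqP; split => // y [].
move=> y [x yx nx].
have [d [B [v [d0 v0 HB]]]] :=
  saddle_repulsion T_sym T_contr T_unit alpha_gt0 L_gt0 alphaL_lt1 F_C2 F_lip nx.
(* The radius [1 / (m + 1)] is at most [d / 2]; with a rational centre within half that radius of
   [x], the ball lies within [d] of [x] and still captures the tail of the orbit. *)
pose m := Num.trunc (2 / d).
have m0 : 0 < m.+1%:R^-1 :> R by rewrite invr_gt0.
have md : 2 * m.+1%:R^-1 <= d.
  rewrite ler_pdivrMr// mulrC -ler_pdivrMr// ltW//; exact: truncnS_gt.
have m2 : 0 < m.+1%:R^-1 / 2 :> R by rewrite divr_gt0.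
have [q] := rat_dense_cV x m2; rewrite -/(ctr q) => Hq.
have [K HK] := (cvg_enormP _ _).1 yx _ m2.
exists (q, m, K) => //; split => /=.
  exists B, v; split => // u w Hu Hw.
  have cl z : enorm (z - ctr q) < m.+1%:R^-1 -> enorm (z - x) < d.
    move=> zq; apply: le_lt_trans (ler_enorm_dist _ (ctr q) _) _.
    by move: Hq zq md m0; set M := _^-1; lra.
  by apply: HB => k; exact: cl.
move=> k /HK yk; apply: le_lt_trans (ler_enorm_dist _ x _) _.
rewrite [enorm (x - _)]enormBC.
by move: Hq yk; set M := _^-1; lra.
Qed.

End SaddleAvoidance.
(** * Powers of the mixing matrix *)

Section MixingMatrix.
Context {R : realType}.

Lemma posdef_unitmx N (A : 'M[R]_N) : posdef A -> A \in unitmx.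
Proof.
move=> [AT A0]; rewrite unitmxE unitfE; apply/det0P => -[v v0 vA].
have vT0 : v^T != 0 by rewrite -trmx0 (inj_eq trmx_inj).
have := A0 _ vT0; rewrite -[A *m v^T]trmxK trmx_mul trmxK AT vA trmx0.
by rewrite dotv0r ltxx.
Qed.

(** The Loewner bounds [0 < A <= 1], stated through quadratic forms so that no diagonalization
    intervenes. *)
Definition posdef_le1 N (A : 'M[R]_N) : Prop :=
  posdef A /\ forall x, dotv x (A *m x) <= dotv x x.

(** Cauchy-Schwarz for the form of [A] at [x] and [A x]: [|A x|^4 <= <x, A x> <A x, A A x> <= <x, A
    x> |A x|^2]. *)
Lemma posdef_le1_contr N (A : 'M[R]_N) x : posdef_le1 A ->
  dotv (A *m x) (A *m x) <= dotv x (A *m x).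
Proof.
move=> [[AT A0] A1].
have Apsd : possemidef A.
  split=> // v; have [->|/A0/ltW//] := eqVneq v 0.
  by rewrite dotv0l.
have := psd_CauchySchwarz x (A *m x) Apsd; rewrite dotv_mulmx AT.
set p := dotv (A *m x) (A *m x); have p0 : 0 <= p := dotv_ge0 _.
have : dotv x (A *m x) * dotv (A *m x) (A *m (A *m x)) <= dotv x (A *m x) * p.
  by rewrite ler_wpM2l// (proj2 Apsd).
move=> /[swap] /le_trans /[apply]; rewrite expr2.
move: p0; rewrite le_eqVlt => /predU1P[<- _|p0]; first exact: (proj2 Apsd).
by rewrite ler_pM2r.
Qed.

(** Induction by steps of two, since [<x, A^(t+2) x> = <A x, A^t (A x)>]; hence the pair of
    consecutive exponents. *)
Lemma posdef_le1_exp N (A : 'M[R]_N) t : posdef_le1 A -> posdef_le1 (A ^+ t).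
Proof.
move=> A01; have [[AT A0] A1] := A01; have Au := posdef_unitmx (proj1 A01).
suff : posdef_le1 (A ^+ t) /\ posdef_le1 (A ^+ t.+1) by case.
elim: t => [|t [IH1 IH2]].
  split=> //; split=> [|x]; last by rewrite expr0 mul1mx.
  by split=> [|v v0]; rewrite expr0 ?trmx1// mul1mx -enorm_sqr exprn_gt0// enorm_gt0.
split=> //; have [[BT B0] B1] := IH1.
have E : A ^+ t.+2 = A *m (A ^+ t *m A) by rewrite exprS exprSr.
have AE x : dotv x (A ^+ t.+2 *m x) = dotv (A *m x) (A ^+ t *m (A *m x)).
  by rewrite E -!mulmxA [LHS]dotv_mulmx AT.
split=> [|x].
  split=> [|v v0]; first by rewrite E !trmx_mul BT AT mulmxA.
  rewrite AE B0//; apply: contra v0 => /eqP Av.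
  by rewrite -[v](mulKmx Au) Av mulmx0.
rewrite AE; apply: le_trans (B1 _) _; apply: le_trans (A1 x).
exact: posdef_le1_contr.
Qed.

(** Unit row and column sums make [<x, x>] the sum of [W i j (x_i^2 + x_j^2) / 2], which dominates
    that of [W i j x_i x_j] term by term. *)
Lemma stochastic_le1 n (W : 'M[R]_n) x : doubly_stochastic W ->
  dotv x (W *m x) <= dotv x x.
Proof.
move=> [W0 W1 W2].
have E : dotv x x = \sum_i \sum_j W i j * ((x i 0 ^+ 2 + x j 0 ^+ 2) / 2).
  under eq_bigr do under eq_bigr do rewrite mulrDl mulrDr.
  under eq_bigr do rewrite big_split /= -mulr_suml W1 mul1r.
  rewrite big_split /= [X in _ + X]exchange_big /=.
  under [X in _ + X]eq_bigr do rewrite -mulr_suml W2 mul1r.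
  by rewrite -big_split; apply: eq_bigr => i _; rewrite -expr2 /=; field.
rewrite E; apply: ler_sum => i _; rewrite mxE mulr_sumr; apply: ler_sum => j _.
rewrite mulrCA ler_wpM2l// ler_pdivlMr//.
by rewrite -subr_ge0 (_ : _ - _ = (x i 0 - x j 0) ^+ 2) ?sqr_ge0//; ring.
Qed.

(** * Kronecker products with the identity *)

Context {n p : nat}.

(** The [j]-th coordinates of all the agents, on which [kronI W] acts as [W]; [block] cuts the
    vector the other way. *)
Definition slice (x : 'cV[R]_(n * p)) (j : 'I_p) : 'cV[R]_n :=
  \col_i x (mxtens_index (i, j)) 0.

Lemma dotv_slice (x y : 'cV[R]_(n * p)) :
  dotv x y = \sum_j dotv (slice x j) (slice y j).
Proof.
rewrite exchange_big pair_bigA /=.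
rewrite /dotv (reindex (@mxtens_index n p)) /=.
  by apply: eq_bigr => -[i j] _; rewrite !mxE.
exists (@mxtens_unindex n p) => k _; [exact: mxtens_indexK|exact: mxtens_unindexK].
Qed.

Lemma slice_kronI (W : 'M[R]_n) (x : 'cV[R]_(n * p)) j :
  slice (kronI W *m x) j = W *m slice x j.
Proof.
apply/colP => i; rewrite !mxE (reindex (@mxtens_index n p)) /=; last first.
  by exists (@mxtens_unindex n p) => k _; [exact: mxtens_indexK|exact: mxtens_unindexK].
rewrite (eq_bigr (fun k : 'I_n * 'I_p =>
  W i k.1 * (j == k.2)%:R * x (mxtens_index (k.1, k.2)) 0)).
  rewrite -(pair_bigA _ (fun k l => W i k * (j == l)%:R * x (mxtens_index (k, l)) 0)) /=.
  apply: eq_bigr => k _; rewrite (bigD1 j)//= eqxx mulr1 big1 ?addr0 ?mxE// => l lj.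
  by rewrite eq_sym (negbTE lj) mulr0 mul0r.
by move=> [k l] _; rewrite tensmxE mxE.
Qed.

Lemma kronI_posdef_le1 (W : 'M[R]_n) : posdef W -> doubly_stochastic W ->
  posdef_le1 (kronI W : 'M[R]_(n * p)).
Proof.
move=> [WT W0] dsW.
have E x : dotv x (kronI W *m x) = \sum_j dotv (slice x j) (W *m slice x j).
  by rewrite dotv_slice; under eq_bigr do rewrite slice_kronI.
split; last first.
  by move=> x; rewrite E [leRHS]dotv_slice; apply: ler_sum => j _; exact: stochastic_le1.
split; first by rewrite /kronI trmx_tens trmx1 WT.
move=> v v0; rewrite E.
have Wge0 u : 0 <= dotv u (W *m u).
  by have [->|/W0/ltW//] := eqVneq u 0; rewrite dotv0l.
rewrite lt_neqAle sumr_ge0// andbT eq_sym psumr_neq0//.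
apply: contrapT => /negP/hasPn H; move: v0 => /negP; apply; apply/eqP/dotv_eq0.
rewrite dotv_slice big1// => j _.
suff -> : slice v j = 0 by rewrite dotv0l.
apply/eqP; apply: contrapT => /negP vj.
by have := H j (mem_index_enum _); rewrite W0.
Qed.

End MixingMatrix.

(** * Almost sure convergence to second order stationary points *)

Theorem mainTheorem3 (R : realType) (n p : nat) (E : rel 'I_n)
    (W : 'M[R]_n) (f : 'I_n -> 'cV[R]_p -> R) (L : R) (t : nat) (alpha : R)
    (P : probability (borel_cV R (n * p)) R) :
  (2 <= n)%N -> (1 <= p)%N ->
  symmetric E -> (forall i j, connect E i j) ->
  mixing_matrix E W ->
  0 < L ->
  (forall x y : 'cV[R]_(n * p),
    enorm (grad (aggregate f) x - grad (aggregate f) y) <= L * enorm (x - y)) ->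
  coercive (aggregate f : 'cV[R]_(n * p) -> R) ->
  KL_function (lyapunov W f t alpha) ->
  C2 (aggregate f : 'cV[R]_(n * p) -> R) ->
  (0 < t)%N -> 0 < alpha -> alpha < 1 / L ->
  strict_saddle_property (lyapunov W f t alpha) ->
  P `<< @lebesgue_cV R (n * p) ->
  {ae P, forall y0 : 'cV[R]_(n * p), exists yinf : 'cV[R]_(n * p),
    near_dgd W f t alpha y0 k @[k --> \oo] --> yinf /\
    second_order_stationary (lyapunov W f t alpha) yinf}.
Proof.
move=> _ _ _ _ [_ dsW pdW _ _] L0 lipF cF KLh F2 _ a0 aL _ PL.
have aL1 : alpha * L < 1 by rewrite -ltr_pdivlMr.
pose F : 'cV[R]_(n * p) -> R := aggregate f.
pose T : 'M[R]_(n * p) := kronI W ^+ t.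
have T01 : posdef_le1 T := posdef_le1_exp t (kronI_posdef_le1 pdW dsW).
have Tu := posdef_unitmx (proj1 T01).
have TT : T^T = T := proj1 (proj1 T01).
have Tc x := posdef_le1_contr x T01.
have Fd : forall y, differentiable F y := proj1 (proj1 F2).
have hE : lyapunov W f t alpha = dgd_lyapunov T F alpha.
  apply/funext => y; rewrite /lyapunov /dgd_lyapunov /T mulmxA.
  by rewrite mul2n -addnn exprD.
have itE y0 k : near_dgd W f t alpha y0 k = iter k (dgd_step T F alpha) y0.
  by elim: k => // k IH; rewrite iterS -IH.
rewrite hE in KLh *.
have := saddle_avoidance TT Tc Tu a0 L0 aL1 F2 lipF PL.
(* Every orbit converges to a critical point, so an exceptional [y0] can only have a limit whose
   Hessian is not positive semidefinite. *)
apply: negligibleS => y0 /= H.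
have [x yx gx] := dgd_converges TT Tc Tu a0 aL1 Fd lipF y0 cF KLh.
exists x => // psd; apply: H; exists x; split.
  by under eq_cvg do rewrite itE.
by split=> //; rewrite /critical grad_lyapunov// gx subrr mulmx0 scaler0.
Qed.
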